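(* Let $\beta=\mathrm{age}_{\mathrm{opt}}$. Then $\beta$ is a root of $$\mathbb E\Big[\int_Y^{\max(\beta-\frac{\mathbb E[Y]}{1-\alpha},\,Y)+Y'}t\,dt\Big]-\beta\,\mathbb E\Big[\max\Big(\beta-Y,\ \frac{\mathbb E[Y]}{1-\alpha}\Big)\Big]=0,$$ and the policy $S_{i+1}=\inf\{t\ge D_i:\ \Delta_t\ge\beta-\frac{\mathbb E[Y]}{1-\alpha}\}$, $i=0,1,\dots$, is optimal for the problem defining $\mathrm{age}_{\mathrm{opt}}$.
   Context: System model: samples are taken at times $S_1\le S_2\le\cdots$, $D_0=0$; sample $i$ has transmission time $Y_i$ and delivery time $D_i=S_i+Y_i$, delivered successfully with probability $1-\alpha$, lost with probability $\alpha\in[0,1)$. The $Y_i$ are i.i.d. copies of a random variable $Y$ with $Y\ge\epsilon>0$ a.s. and $\mathbb E[Y^2]<\infty$; success indicators are i.i.d. and independent of $(Y_i)$. Outcomes are known at $D_i$ and $S_{i+1}\ge D_i$. For $t\in[D_i,D_{i+1})$ the age is $\Delta_t=t-S_{\underline i}$, where $\underline i$ is the largest index $\le i$ whose sample was successfully delivered. $\Pi_{\text{signal-agnostic}}$ is the set of policies with $S_i\ge D_{i-1}$, sampling decisions depending only on past timing/outcome information (independent of the Wiener source), and $S_i-D_{i-1}$ bounded by a random variable with finite second moment independent of the history before $S_{i-1}$. $\mathrm{age}_{\mathrm{opt}}=\inf_{\Pi_{\text{signal-agnostic}}}\limsup_{T\to\infty}\frac1T\mathbb E[\int_0^T\Delta_tdt]$.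 In the root equation, $M$ is geometric with $P(M=m)=\alpha^{m-1}(1-\alpha)$, $m\ge1$, $Y,Y_{1},Y_{2},\dots$ are i.i.d. copies of $Y$ independent of $M$, and $Y'=\sum_{k=1}^M Y_k$. *)

(* Defs.v *)
From HB Require Import structures.
From mathcomp Require Import all_boot all_order all_algebra.
From mathcomp Require Import all_classical all_reals all_analysis.
Set Implicit Arguments. Unset Strict Implicit. Unset Printing Implicit Defensive.
Import Order.TTheory GRing.Theory Num.Theory.
Import numFieldNormedType.Exports.
Local Open Scope classical_set_scope.
Local Open Scope ring_scope.

Definition law_eq {d} {Omega : measurableType d} {R : realType} (P : probability Omega R) {d'} {Omega' : measurableType d'} (P' : probability Omega' R)
  (X : Omega -> R) (X' : Omega' -> R) : Prop :=
  forall B : set R, measurable B -> P (X @^-1` B) = P' (X' @^-1` B).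

Definition mutually_independent {d} {Omega : measurableType d} {R : realType} (P : probability Omega R) {I : eqType} (X : I -> Omega -> R) : Prop :=
  forall (J : seq I) (B : I -> set R), uniq J -> (forall i, measurable (B i)) ->
    fine (P (\big[setI/setT]_(i <- J) (X i @^-1` B i)))
    = \prod_(i <- J) fine (P (X i @^-1` B i)).


Section model.
Context {d : measure_display} {Omega : measurableType d} {R : realType}.
Variable P : probability Omega R.

Definition sigma_gen (Xs : set (Omega -> R)) : set (set Omega) :=
  <<s [set A | exists2 X, Xs X & exists2 B : set R, measurable B & A = X @^-1` B] >>.

Definition measurable_wrt (F : set (set Omega)) (Z : Omega -> R) : Prop :=
  forall B : set R, measurable B -> F (Z @^-1` B).

Definition indep_sigma (F G : set (set Omega)) : Prop :=
  forall A B, F A -> G B -> P (A `&` B) = (P A * P B)%E.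

Definition succR (succ : nat -> Omega -> bool) (k : nat) : Omega -> R :=
  fun w => (succ k w)%:R.

(** the system family: transmission times Y_i and success indicators, i >= 1 *)
Definition sys_family (Y : nat -> Omega -> R) (succ : nat -> Omega -> bool)
  (x : nat + nat) : Omega -> R :=
  match x with inl k => Y k.+1 | inr k => succR succ k.+1 end.

(** A policy: an auxiliary randomization source U and the waiting times
    Z_i = S_{i+1} - D_i (i >= 0). *)
Record policy := Policy { pol_U : Omega -> R; pol_Z : nat -> Omega -> R }.

Section dynamics.
Variables (Y : nat -> Omega -> R) (succ : nat -> Omega -> bool) (pi : policy).

Fixpoint deliv (i : nat) (w : Omega) : R :=
  match i with 0%N => 0 | j.+1 => deliv j w + pol_Z pi j w + Y j.+1 w end.

(** S_0 = 0 (fictitious initial sample, delivered at D_0 = 0), S_{i+1} = D_i + Z_i *)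
Definition samp (i : nat) (w : Omega) : R :=
  match i with 0%N => 0 | j.+1 => deliv j w + pol_Z pi j w end.

Definition delivered (k : nat) (w : Omega) : bool := (k == 0)%N || succ k w.

(** Age: Delta_t = t - S_{underline i}, where underline i is the latest
    successfully delivered sample among those delivered by time t. *)
Definition age (t : R) (w : Omega) : R :=
  t - sup [set samp k w | k in [set k | delivered k w /\ deliv k w <= t]].

Definition avg_age (T : R) : \bar R :=
  ((T^-1)%:E * \int[P]_w (\int[@lebesgue_measure R]_(t in `[0%R, T]) (age t w)%:E))%E.

Definition avg_cost : \bar R := limf_esup avg_age (pinfty_nbhs R).

Definition in_Pi : Prop :=
  [/\ measurable_fun setT (pol_U pi),
      indep_sigma (sigma_gen [set pol_U pi])
                  (sigma_gen [set X | exists x, X = sys_family Y succ x]),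
      (forall i w, 0 <= pol_Z pi i w),
      (forall i, measurable_wrt
         (sigma_gen [set X | X = pol_U pi \/
            exists2 k, (1 <= k <= i)%N & (X = Y k \/ X = succR succ k)])
         (pol_Z pi i)) &
      (* S_{n+1} - D_n bounded by a r.v. with finite second moment, independent
         of the history before S_n *)
      (forall n : nat, exists B : Omega -> R,
         [/\ measurable_fun setT B,
             {ae P, forall w, pol_Z pi n w <= B w},
             ('E_P[fun w => (B w ^+ 2)%R] < +oo)%E &
             indep_sigma (sigma_gen [set B])
               (sigma_gen [set X |
                  (exists2 k, (1 <= k < n)%N & (X = Y k \/ X = succR succ k)) \/
                  (exists2 k, (k.+2 <= n)%N & X = pol_Z pi k)])])].

Definition threshold_policy (theta : R) : Prop :=
  forall i : nat, {ae P, forall w,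
    samp i.+1 w = inf [set t | deliv i w <= t /\ theta <= age t w]}.

End dynamics.

Definition age_opt (Y : nat -> Omega -> R) (succ : nat -> Omega -> bool) : \bar R :=
  ereal_inf [set avg_cost Y succ pi | pi in [set pi | in_Pi Y succ pi]].

Definition cY (Y : nat -> Omega -> R) (alpha : R) : R :=
  fine ('E_P[Y 1%N]) / (1 - alpha).

(** The root equation, stated for every realization of
    Y, M (geometric), Y_1, Y_2, ... (i.i.d. copies of Y, independent of M). *)
Definition root_eq (Y : nat -> Omega -> R) (alpha beta : R) : Prop :=
  forall (d' : measure_display) (Omega' : measurableType d') (P' : probability Omega' R)
    (Yr : Omega' -> R) (M : Omega' -> nat) (Ys : nat -> Omega' -> R),
    measurable_fun setT Yr ->
    measurable_fun setT (fun w => (M w)%:R : R) ->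
    (forall k, measurable_fun setT (Ys k)) ->
    law_eq P P' (Y 1%N) Yr ->
    (forall k, (1 <= k)%N -> law_eq P P' (Y 1%N) (Ys k)) ->
    (forall m, (1 <= m)%N -> P' [set w | M w = m] = (alpha ^+ m.-1 * (1 - alpha))%:E) ->
    mutually_independent P'
      (fun k : nat => match k with
                      | 0%N => Yr
                      | 1%N => fun w => (M w)%:R
                      | k'.+2 => Ys k'.+1 end) ->
    let c := cY Y alpha in
    let Y' := fun w => \sum_(1 <= k < (M w).+1) Ys k w in
    (\int[P']_w (\int[@lebesgue_measure R]_(t in `[Yr w, (Num.max (beta - c) (Yr w) + Y' w)%R]) t%:E)
     - beta%:E * 'E_P'[fun w => Num.max (beta - Yr w)%R c])%E = 0%E.

End model.

(* Main.v *)
Require Import Defs.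
From HB Require Import structures.
From mathcomp Require Import all_boot all_order all_algebra.
From mathcomp Require Import all_classical all_reals all_analysis.
From mathcomp Require Import measurable_realfun ring lra.
Import Order.TTheory GRing.Theory Num.Theory.
Import numFieldNormedType.Exports.
Local Open Scope classical_set_scope.
Local Open Scope ring_scope.
Set Implicit Arguments.
Unset Strict Implicit.
Unset Printing Implicit Defensive.

(** Write [c = E Y / (1 - alpha)] and [theta = beta - c].  The relative value
    function [h x = K + max (x - theta) 0 ^ 2 / 2 - x ^ 2 / 2 + beta * x] solves the
    average-cost Bellman equation with gain [beta] as soon as [E (h Y) = 0], which is
    the root equation; a root with [theta >= 0] exists by the intermediate value
    theorem.  For every policy, the cost minus [beta] times the elapsed time plus
    [h (age)] is a submartingale along the delivery times, and a martingale for the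
    threshold policy.  Stopping it at the first delivery after [T] compares
    [E (int_0^T age)] with [beta * T]: the overshoot involves only the square of the
    last transmission time, whose mean is [o(T)] since [E (Y ^ 2)] is finite, and the
    age [A] at time [T], which is controlled by [A ^ 2 / 2 <= int_0^T age]. *)

(** No conditional expectation and no stopping theorem is used. Transmissions last at least [eps],
    so [n] slots with [n * eps > T] cover [[0, T]] on every path, and stopping at [T] becomes the
    indicator [path_deliv i <= T] inside a sum with a fixed number of terms. The obstacle to
    averaging one term is the positive part in [h], which after a failure mixes the past with the
    next step. Minorizing it gives a sum of products of independent factors, whose mean is
    [(1 - alpha) / 2] times that of [(b - theta) ^ 2 - max (b - theta) 0 ^ 2], with [b] the age at
    sampling. This is nonnegative and vanishes for [b >= theta]; for the threshold choice
    [b = max a theta] the minorant is moreover exact. To keep every term integrable, the lower bound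
    cuts the waits at [T - D_i], so that ages stay in [[0, T]]. Absorbing the terminal terms costs a
    factor [1 + delta] on the cost, with [delta] fixed before [T] grows. *)

(** * Integrals and independence *)

Section ae_integral.
Context d (T : measurableType d) (R : realType) (mu : {measure set T -> \bar R}).
Local Open Scope ereal_scope.
Import HBNNSimple.

(** Stated without measurability, since the time integral of the age is only known to agree almost
    everywhere with a measurable function of the outcome. A simple function below [f], cut to the
    complement of the null set, lies below [g] and keeps its integral. *)
Lemma ge0_le_integral_ae (f g : T -> \bar R) :
  (forall x, 0 <= f x) -> (forall x, 0 <= g x) ->
  {ae mu, forall x, f x <= g x} ->
  \int[mu]_x f x <= \int[mu]_x g x.
Proof.
move=> f0 g0 [N [mN N0 subN]].
rewrite (ge0_integralE mu (f := f))// (ge0_integralE mu (f := g))//.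
rewrite !patch_setT; apply: ge_ereal_sup => _ [h /= hf <-].
have mC : measurable (~` N) by exact: measurableC.
have [h' h'E] : exists h' : {nnsfun T >-> R},
    forall x, h' x = (h x * \1_(~` N) x)%R by exists (proj_nnsfun h mC).
have -> : sintegral mu h = sintegral mu h'.
  rewrite -!integralT_nnsfun; apply: ge0_ae_eq_integral => //.
  - exact/measurable_EFinP/measurable_funP.
  - exact/measurable_EFinP/measurable_funP.
  - by move=> x _; rewrite lee_fin.
  - by move=> x _; rewrite lee_fin.
  exists N; split => // x /= hx; apply: contrapT => Nx; apply: hx => _.
  by rewrite h'E indicE mem_set//= mulr1.
apply: ereal_sup_ubound; exists h' => //= x; rewrite h'E indicE.
have [xN|xN] := pselect (N x); last first.
  rewrite mem_set//= mulr1; apply: (le_trans (hf x)).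
  by apply: contrapT => H; apply: xN; exact: subN.
by rewrite memNset//= ?mulr0//; apply/not_notP.
Qed.

Lemma eq_integral_ae (f g : T -> \bar R) :
  {ae mu, forall x, f x = g x} -> \int[mu]_x f x = \int[mu]_x g x.
Proof.
move=> fg; rewrite integralE [RHS]integralE; congr (_ - _).
- apply/eqP; rewrite eq_le; apply/andP; split.
  + by apply: ge0_le_integral_ae => //; apply: filterS fg => x; rewrite unlock => ->.
  + by apply: ge0_le_integral_ae => //; apply: filterS fg => x; rewrite unlock => ->.
- apply/eqP; rewrite eq_le; apply/andP; split.
  + by apply: ge0_le_integral_ae => //; apply: filterS fg => x; rewrite unlock => ->.
  + by apply: ge0_le_integral_ae => //; apply: filterS fg => x; rewrite unlock => ->.
Qed.

End ae_integral.

Section independence.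
Context {d : measure_display} {Omega : measurableType d} {R : realType}.
Variable P : probability Omega R.

(** Independence makes the law of the pair [(X, W)] the product of the marginal laws, so both claims
    are Fubini's theorem for [(x, y) -> x * y]. *)
Lemma indep_integral (X W : Omega -> R) :
  measurable_fun setT X -> measurable_fun setT W ->
  (forall A B : set R, measurable A -> measurable B ->
     P (X @^-1` A `&` W @^-1` B) = (P (X @^-1` A) * P (W @^-1` B))%E) ->
  P.-integrable setT (EFin \o X) -> P.-integrable setT (EFin \o W) ->
  P.-integrable setT (EFin \o (fun w => X w * W w)) /\
  \int[P]_w (X w * W w) = \int[P]_w X w * \int[P]_w W w.
Proof.
move=> mX mW ind iX iW.
pose X' : {mfun Omega >-> R} := HB.pack X (isMeasurableFun.Build _ _ _ _ _ mX).
pose W' : {mfun Omega >-> R} := HB.pack W (isMeasurableFun.Build _ _ _ _ _ mW).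
have mXW : measurable_fun setT (fun w => (X w, W w)).
  by apply/measurable_fun_pairP.
pose XW : {mfun Omega >-> (R * R)%type} :=
  HB.pack (fun w => (X w, W w)) (isMeasurableFun.Build _ _ _ _ _ mXW).
pose m1 : probability R R := distribution P X'.
pose m2 : probability R R := distribution P W'.
have prodE A : measurable A -> (m1 \x m2)%E A = distribution P XW A.
  by move=> mA; apply: product_measure_unique => //= B C mB mC; exact: ind.
have m12 : measurable_fun setT (fun z : R * R => (z.1 * z.2)%:E).
  by apply/measurable_EFinP; apply: measurable_funM.
have intabs : (\int[m1]_x \int[m2]_y `|(x * y)%:E| < +oo)%E.
  have -> : (\int[m1]_x \int[m2]_y `|(x * y)%:E|)%E =
            (\int[m1]_x (`|x|%:E * \int[m2]_y `|y|%:E))%E.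
    apply: eq_integral => x _; rewrite -ge0_integralZl//=.
    - by apply: eq_integral => y _; rewrite normrM EFinM.
    - by apply/measurable_EFinP; exact: normr_measurable.
  have i2 : (\int[m2]_y `|y|%:E < +oo)%E.
    rewrite ge0_integral_distribution//; last first.
      by apply/measurable_EFinP; exact: normr_measurable.
    by move/integrableP : iW => [_].
  have i1 : (\int[m1]_y `|y|%:E < +oo)%E.
    rewrite ge0_integral_distribution//; last first.
      by apply/measurable_EFinP; exact: normr_measurable.
    by move/integrableP : iX => [_].
  rewrite ge0_integralZr//.
  - by apply: lte_mul_pinfty => //; [exact: integral_ge0|rewrite ge0_fin_numE//; exact: integral_ge0].
  - by apply/measurable_EFinP; exact: normr_measurable.
  - exact: integral_ge0.
have ip : (m1 \x m2)%E.-integrable setT (fun z : R * R => (z.1 * z.2)%:E).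
  exact/integrable12ltyP.
have iXW : P.-integrable setT (EFin \o (fun w => X w * W w)).
  apply/integrableP; split; first by apply/measurable_EFinP; exact: measurable_funM.
  move/integrableP : ip => [_].
  rewrite (eq_measure_integral (distribution P XW)) => [|A mA _]; last exact: prodE.
  by rewrite ge0_integral_distribution//; exact: measurableT_comp.
split => //.
have E : (\int[P]_w (X w * W w)%:E = \int[P]_w (X w)%:E * \int[P]_w (W w)%:E)%E.
  transitivity (\int[m1 \x m2]_z (z.1 * z.2)%:E)%E.
    rewrite (eq_measure_integral (distribution P XW)) => [|A mA _]; last exact: prodE.
    by rewrite integral_distribution.
  rewrite -integral12_prod_meas1// /fubini_F.
  have i2 : m2.-integrable setT (EFin : R -> \bar R).
    by apply: integrable_pushforward => //; exact: measurable_funP.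
  have i1 : m1.-integrable setT (EFin : R -> \bar R).
    by apply: integrable_pushforward => //; exact: measurable_funP.
  transitivity (\int[m1]_x (x%:E * \int[m2]_y y%:E))%E.
    by apply: eq_integral => x _ /=; rewrite -integralZl.
  rewrite -[X in (_ = \int[P]_w _ * X)%E](@integral_distribution _ _ _ _ _ P W' EFin)//.
  rewrite -[X in (_ = X * _)%E](@integral_distribution _ _ _ _ _ P X' EFin)//.
  rewrite -/m1 -/m2 -[X in (_ * X)%E]fineK ?integrable_fin_num//.
  by rewrite -[in RHS]integralZr// fineK ?integrable_fin_num.
by rewrite /Rintegral E fineM//; exact: integrable_fin_num.
Qed.

(** With [B] fixed, [P (A & B)] and [P A * P B] are finite measures in [A] that agree on a
    pi-system, hence on the generated sigma-algebra; this is applied to each factor in turn. *)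
Lemma indep_sigma_pi (G1 G2 : set (set Omega)) :
  G1 `<=` measurable -> G2 `<=` measurable ->
  setI_closed G1 -> setI_closed G2 -> G1 setT -> G2 setT ->
  (forall A B, G1 A -> G2 B -> P (A `&` B) = (P A * P B)%E) ->
  indep_sigma P <<s G1 >> <<s G2 >>.
Proof.
move=> mG1 mG2 I1 I2 T1 T2 H12.
have gen (G : set (set Omega)) (B : set Omega) : G `<=` measurable ->
    setI_closed G -> G setT -> measurable B ->
    (forall A, G A -> P (A `&` B) = (P A * P B)%E) ->
    forall A, <<s G >> A -> P (A `&` B) = (P A * P B)%E.
  move=> mG IG TG mB HG A sA.
  have PB0 : 0 <= fine (P B) by rewrite fine_ge0.
  rewrite -[P B]fineK ?fin_num_measure// muleC.
  pose m1 : {measure set Omega -> \bar R} := mrestr P mB.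
  pose m2 : {measure set Omega -> \bar R} := mscale (NngNum PB0) P.
  apply: (@g_sigma_algebra_measure_unique _ _ _ G mG (fun=> setT) _ _ m1 m2) => //.
  - by rewrite bigcup_const//; exists 0%N.
  - by move=> C GC /=; rewrite /mrestr /mscale/= HG// fineK ?fin_num_measure// muleC.
  - move=> _; rewrite /= /mrestr; apply: (@le_lt_trans _ _ (P setT)).
      by apply: le_measure; rewrite ?inE//; exact: measurableI.
    by rewrite probability_setT ltry.
have sm G : G `<=` measurable -> <<s G >> `<=` @measurable _ Omega.
  by move=> mG; apply: smallest_sub => //; exact: sigma_algebra_measurable.
move=> A B sA sB.
apply: (gen G1) => //; first exact: (sm _ mG2).
move=> C GC; rewrite setIC muleC; apply: (gen G2) => //; first exact: mG1.
by move=> E GE; rewrite setIC muleC; exact: H12.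
Qed.

(** The finite intersections [G J] of events on indices of [J] form a pi-system generating the
    block. For two disjoint blocks the index lists can be concatenated without repetition, and the
    product formula factors. *)
Lemma mutually_independent_blocks {I : eqType} (X : I -> Omega -> R)
    (J1 J2 : set I) :
  (forall i, measurable_fun setT (X i)) -> mutually_independent P X ->
  J1 `&` J2 = set0 ->
  indep_sigma P (sigma_gen [set f | exists2 i, J1 i & f = X i])
                (sigma_gen [set f | exists2 i, J2 i & f = X i]).
Proof.
move=> mX mi J12.
pose G (J : set I) : set (set Omega) := [set A | exists (s : seq I) (B : I -> set R),
  [/\ uniq s, (forall i, i \in s -> J i), (forall i, measurable (B i)) &
      A = \big[setI/setT]_(i <- s) (X i @^-1` B i)]].
have bigP (s : seq I) (B : I -> set R) :
    \big[setI/setT]_(i <- s) (X i @^-1` B i) = [set w | forall i, i \in s -> B i (X i w)].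
  elim: s => [|i s IH]; first by rewrite big_nil; apply/seteqP; split.
  rewrite big_cons IH; apply/seteqP; split => w /=.
    by move=> [h1 h2] j; rewrite inE => /orP[/eqP ->//|]; exact: h2.
  by move=> h; split=> [|j js]; apply: h; rewrite inE ?eqxx// js orbT.
have mpre i B : measurable B -> measurable (X i @^-1` B).
  by move=> mB; rewrite -[_ @^-1` _]setTI; exact: mX.
have mG J : G J `<=` measurable.
  move=> _ [s [B [us sJ mB ->]]]; elim: s {us sJ} => [|i s IH]; first by rewrite big_nil.
  by rewrite big_cons; apply: measurableI => //; exact: mpre.
have IG J : setI_closed (G J).
  move=> _ _ [s [B [us sJ mB ->]]] [t [C [ut tJ mC ->]]].
  exists (undup (s ++ t)), (fun i => (if i \in s then B i else setT) `&`
                                     (if i \in t then C i else setT)).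
  split; first exact: undup_uniq.
  - by move=> i; rewrite mem_undup mem_cat => /orP[/sJ|/tJ].
  - by move=> i; apply: measurableI; case: ifP.
  rewrite !bigP; apply/seteqP; split => w /=.
    move=> [h1 h2] i _; split; first by case: ifPn => // /h1.
    by case: ifPn => // /h2.
  move=> h; split => i ii.
    by have := h i; rewrite mem_undup mem_cat ii => /(_ isT)[].
  by have := h i; rewrite mem_undup mem_cat ii orbT => /(_ isT)[].
have TG J : G J setT by exists [::], (fun=> setT); split => //; rewrite big_nil.
have sG J : sigma_gen [set f | exists2 i, J i & f = X i] `<=` <<s G J >>.
  apply: smallest_sub; first exact: smallest_sigma_algebra.
  move=> _ [_ [i Ji ->] [B mB ->]]; apply: sub_sigma_algebra.
  exists [:: i], (fun=> B); split => //; last by rewrite big_seq1.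
  by move=> j; rewrite inE => /eqP ->.
have key : forall A B, G J1 A -> G J2 B -> P (A `&` B) = (P A * P B)%E.
  move=> A B GA GB.
  have mA := mG _ _ GA; have mB := mG _ _ GB.
  move: GA GB => [s [SB [us sJ mSB AE]]] [t [TB [ut tJ mTB BE]]].
  have st i : i \in s -> i \in t -> False.
    by move=> /sJ ? /tJ ?; have : (J1 `&` J2) i by []; rewrite J12.
  pose C i := if i \in s then SB i else TB i.
  have mC i : measurable (C i) by rewrite /C; case: ifP.
  have EA : A = \big[setI/setT]_(i <- s) (X i @^-1` C i).
    rewrite AE; apply: eq_big_seq => i ii; by rewrite /C ii.
  have EB : B = \big[setI/setT]_(i <- t) (X i @^-1` C i).
    rewrite BE; apply: eq_big_seq => i ii; rewrite /C; case: ifPn => // /st.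
    by move/(_ ii).
  have ust : uniq (s ++ t).
    rewrite cat_uniq us ut andbT/=; apply/hasPn => i it; apply/negP => /= is_.
    exact: (st i).
  have /= := mi (s ++ t) C ust mC; rewrite big_cat/= -EA -EB big_cat/=.
  rewrite -(mi s C us mC) -(mi t C ut mC) -EA -EB => E.
  rewrite -[LHS]fineK ?fin_num_measure//; last exact: measurableI.
  by rewrite E EFinM !fineK ?fin_num_measure.
move=> A B /sG sA /sG sB.
exact: (indep_sigma_pi (mG J1) (mG J2)).
Qed.

End independence.

(** * Value function and path estimates *)

Section minmax.
Context {R : realType}.
Implicit Types x y : R.

Lemma maxr_idl x y : y <= x -> Num.max x y = x.
Proof. by move=> h; apply/max_idPl. Qed.

Lemma maxr_idr x y : x <= y -> Num.max x y = y.
Proof. by move=> h; apply/max_idPr. Qed.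

Lemma minr_idl x y : x <= y -> Num.min x y = x.
Proof. by move=> h; apply/min_idPl. Qed.

Lemma minr_idr x y : y <= x -> Num.min x y = y.
Proof. by move=> h; apply/min_idPr. Qed.

End minmax.

Section value_function.
Context {R : realType}.
Variables (c theta K : R).
Local Notation beta := (theta + c).

(* [relval x] is the expected cost, minus [beta] times the expected duration, of
   the remainder of a cycle at age [x] under the threshold policy; [K] is the
   constant for which the root equation reads [E (relval Y) = 0]. *)
Definition relval (x : R) : R :=
  K + Num.max (x - theta) 0 ^+ 2 / 2 - x ^+ 2 / 2 + beta * x.

Lemma relval0 : 0 <= theta -> relval 0 = K.
Proof.
move=> theta0.
rewrite /relval (_ : Num.max (0 - theta) 0 = 0); last by apply: maxr_idr; lra.
by rewrite expr0n/= mul0r mulr0 subr0 !addr0.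
Qed.

(** Beyond [theta] the squares cancel and [relval x] is [K + theta ^ 2 / 2 + c * x]; below it,
    [beta * x - x ^ 2 / 2] is at most [beta ^ 2 / 2]. This merely linear growth lets the running
    cost absorb the terminal value. *)
Lemma relval_le (x : R) : 0 <= c -> 0 <= x ->
  relval x <= K + theta ^+ 2 / 2 + beta ^+ 2 / 2 + c * x.
Proof.
move=> c0 x0; rewrite /relval; have cx : 0 <= c * x by exact: mulr_ge0.
have := sqr_ge0 beta; have := sqr_ge0 theta; have := sqr_ge0 (x - beta).
rewrite !expr2; have [h|h] := leP (x - theta) 0 => ? ? ?; lra.
Qed.

(** Allows the terminal value to be dropped against the initial one, [relval 0 = K], in the upper
    bound on the cost. *)
Lemma relval_ge (x : R) : 0 <= c -> 0 <= theta -> 0 <= x -> K <= relval x.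
Proof.
move=> c0 theta0 x0; rewrite /relval; have cx : 0 <= c * x by exact: mulr_ge0.
have := sqr_ge0 theta; rewrite !expr2.
have [h|h] := leP (x - theta) 0 => ?; last by lra.
have : 0 <= x * (theta - x) by apply: mulr_ge0 => //; lra.
have : 0 <= x * theta by apply: mulr_ge0.
lra.
Qed.

(* [a] is the age at a delivery, [b] the age at the next sampling time, [y] the
   transmission time of that sample and [s] its outcome. *)
Definition drift (s : bool) (a b y : R) : R :=
  ((b + y) ^+ 2 - a ^+ 2) / 2 - beta * (b - a + y)
  + relval (if s then y else b + y) - relval a.

(* In [drift], the failure term [max (b + y - theta) 0 ^ 2] is minorized by
   [y ^ 2 + 2 * y * (b - theta) + max (b - theta) 0 ^ 2]: the result is a sum of
   products of a function of [b] (the past) and one of [(y, s)] (the next step). *)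
Definition drift_lb (s : bool) (b y : R) : R :=
  b ^+ 2 * (s%:R / 2) + b * (y - beta * s%:R)
  + (y ^+ 2 / 2 - theta * y + s%:R * (- c * y - K + relval y))
  - Num.max (b - theta) 0 ^+ 2 * (s%:R / 2).

(** All terms in [a] cancel against [relval a] except [- max (a - theta) 0 ^ 2 / 2], which only
    decreases when [a] is replaced by [b]. The rest is the minoration of the failure term. *)
Lemma drift_ge s (a b y : R) : 0 <= y -> a <= b -> drift_lb s b y <= drift s a b y.
Proof.
move=> y0 ab; rewrite /drift /drift_lb.
have ua : Num.max (a - theta) 0 ^+ 2 <= Num.max (b - theta) 0 ^+ 2.
  by apply: lerXn2r; rewrite ?nnegrE;
    have [h1|h1] := leP (a - theta) 0; have [h2|h2] := leP (b - theta) 0; lra.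
have ub : y ^+ 2 + 2 * y * (b - theta) + Num.max (b - theta) 0 ^+ 2
          <= Num.max (b + y - theta) 0 ^+ 2.
  have := sqr_ge0 (b + y - theta); rewrite !expr2.
  have [h|h] := leP (b - theta) 0; have [h'|h'] := leP (b + y - theta) 0 => ?.
  - have : 0 <= y * (- (b + y - theta)) by apply: mulr_ge0 => //; lra.
    have : 0 <= y * (- (b - theta)) by apply: mulr_ge0 => //; lra.
    by lra.
  - have := sqr_ge0 (b - theta); rewrite expr2; lra.
  - lra.
  - lra.
case: s => /=; rewrite /relval !expr2 in ua ub *; lra.
Qed.

(** Both inequalities behind [drift_ge] become equalities: [b = max a theta] has the same excess
    over [theta] as [a], and [b >= theta] leaves no positive part to minorize. *)
Lemma drift_max s (a y : R) : 0 <= y ->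
  drift s a (Num.max a theta) y = drift_lb s (Num.max a theta) y.
Proof.
move=> y0; rewrite /drift /drift_lb /relval.
have [h|h] := leP a theta.
  rewrite (_ : Num.max (theta - theta) 0 = 0); last by rewrite subrr maxxx.
  rewrite (_ : Num.max (a - theta) 0 = 0); last by apply: maxr_idr; lra.
  have E : Num.max (theta + y - theta) 0 = y.
    by rewrite addrAC subrr add0r; apply: maxr_idl.
  by case: s => /=; rewrite ?E; field.
rewrite (_ : Num.max (a - theta) 0 = a - theta); last by apply: maxr_idl; lra.
have E : Num.max (a + y - theta) 0 = a + y - theta by apply: maxr_idl; lra.
by case: s => /=; rewrite ?E; field.
Qed.

End value_function.

(** * Deterministic trajectories seen up to a fixed horizon *)

Section path.
Context {R : realType}.
Variables (y z : nat -> R) (s : nat -> bool).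

Fixpoint path_deliv (i : nat) : R :=
  if i is j.+1 then path_deliv j + z j + y j.+1 else 0.

Fixpoint path_last (i : nat) : R :=
  if i is j.+1 then (if s j.+1 then path_deliv j + z j else path_last j) else 0.

Definition path_age i := path_deliv i - path_last i.

(** The integral of the age over [[0, T]] once [path_deliv n > T], slot by slot: on slot [i] the age
    has slope one and starts from [path_age i]. *)
Definition path_cost (T : R) (n : nat) : R :=
  \sum_(i < n) (path_deliv i <= T)%R%:R *
    (((Num.min (path_deliv i.+1) T - path_last i) ^+ 2 - path_age i ^+ 2) / 2).

(** The squared transmission time of the slot that straddles [T]. *)
Definition path_over (T : R) (n : nat) : R :=
  \sum_(i < n) (path_deliv i <= T)%R%:R * (~~ (path_deliv i.+1 <= T)%R)%:R * y i.+1 ^+ 2.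

Lemma path_costS T n : path_cost T n.+1 = path_cost T n + (path_deliv n <= T)%R%:R *
    (((Num.min (path_deliv n.+1) T - path_last n) ^+ 2 - path_age n ^+ 2) / 2).
Proof. by rewrite /path_cost big_ord_recr. Qed.

Lemma path_overS T n : path_over T n.+1 = path_over T n +
  (path_deliv n <= T)%R%:R * (~~ (path_deliv n.+1 <= T)%R)%:R * y n.+1 ^+ 2.
Proof. by rewrite /path_over big_ord_recr. Qed.

Lemma path_ageS i : path_age i.+1 = if s i.+1 then y i.+1 else path_age i + z i + y i.+1.
Proof. by rewrite /path_age/=; case: ifP; lra. Qed.

Lemma path_over_ge0 T n : 0 <= path_over T n.
Proof.
by apply: sumr_ge0 => i _; apply: mulr_ge0; [apply: mulr_ge0; exact: ler0n|exact: sqr_ge0].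
Qed.

Variable eps : R.
Hypotheses (eps0 : 0 < eps) (yeps : forall i, eps <= y i.+1) (z0 : forall i, 0 <= z i).

Lemma y_ge0 i : 0 <= y i.+1.
Proof. exact: le_trans (ltW eps0) (yeps i). Qed.

Lemma path_delivS_ge i : path_deliv i + eps <= path_deliv i.+1.
Proof. by rewrite /=; have := z0 i; have := yeps i; lra. Qed.

Lemma path_delivS i : path_deliv i <= path_deliv i.+1.
Proof. by apply: le_trans (path_delivS_ge i); have := eps0; lra. Qed.

Lemma path_deliv_mono i j : (i <= j)%N -> path_deliv i <= path_deliv j.
Proof. by move/(homo_leq (fun x => lexx x) le_trans path_delivS). Qed.

Lemma path_deliv_ge i : i%:R * eps <= path_deliv i.
Proof.
elim: i => [|i IH]; first by rewrite mul0r.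
apply: le_trans (path_delivS_ge i); rewrite -natr1 mulrDl mul1r; lra.
Qed.

Lemma path_last_le i : path_last i <= path_deliv i.
Proof.
elim: i => [|i IH]//=; have := z0 i; have := y_ge0 i.
case: ifP; lra.
Qed.

Lemma path_lastS i : path_last i <= path_last i.+1.
Proof. by move=> /=; case: ifP => //; have := path_last_le i; have := z0 i; lra. Qed.

Lemma path_last_ge0 i : 0 <= path_last i.
Proof. by elim: i => [|i IH]//; apply: le_trans IH (path_lastS i). Qed.

Lemma path_age_ge0 i : 0 <= path_age i.
Proof. by rewrite /path_age subr_ge0 path_last_le. Qed.

Lemma path_age_le i : path_age i <= path_deliv i.
Proof. by rewrite /path_age; have := path_last_ge0 i; lra. Qed.

Definition tail (Q x : R) : R := if Q < x then x ^+ 2 else 0.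

(* At most one term of [path_over] is nonzero, so only the summands above the level [Q]
   accumulate; this makes the mean of [path_over] sublinear in [T]. *)
Lemma path_over_le T n Q : 0 <= Q ->
  path_over T n <= Q ^+ 2 + \sum_(i < n) tail Q (y i.+1).
Proof.
move=> Q0.
have tail0 x : 0 <= tail Q x by rewrite /tail; case: ifP => // _; exact: sqr_ge0.
have sqle x : 0 <= x -> x ^+ 2 <= Q ^+ 2 + tail Q x.
  move=> x0; rewrite /tail; case: ltP => h; first by rewrite lerDr sqr_ge0.
  by rewrite addr0; apply: lerXn2r; rewrite ?nnegrE.
suff H n' : (path_deliv n' <= T -> path_over T n' = 0) /\
    path_over T n' <= Q ^+ 2 + \sum_(i < n') tail Q (y i.+1) by exact: (H n).2.
elim: n' => [|i [IH1 IH2]].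
  by rewrite /path_over !big_ord0 addr0; split => //; exact: sqr_ge0.
rewrite path_overS big_ord_recr/= -/(path_deliv i.+1); split=> [DT|].
  rewrite IH1; last exact: le_trans (path_delivS i) DT.
  by rewrite (_ : (path_deliv i.+1 <= T) = true)// mulr0 mul0r addr0.
have t0 := tail0 (y i.+1).
have S0 : 0 <= \sum_(j < i) tail Q (y j.+1) by exact: sumr_ge0.
have [h|h] := leP (path_deliv i) T; last by rewrite !mul0r addr0 addrA; lra.
rewrite IH1// add0r mul1r; have := sqle _ (y_ge0 i).
by case: (_ <= T); rewrite /= ?mul0r ?mul1r; have := sqr_ge0 Q; lra.
Qed.

Variables (c theta K T : R).
Hypotheses (c0 : 0 <= c) (theta0 : 0 <= theta) (T0 : 0 <= T).
Local Notation beta := (theta + c).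
Local Notation rv := (relval c theta K).
Local Notation dr := (drift c theta K).

Definition path_drift (b : nat -> R) n :=
  \sum_(i < n) (path_deliv i <= T)%R%:R * dr (s i.+1) (path_age i) (b i) (y i.+1).

Lemma path_driftS b n : path_drift b n.+1 = path_drift b n +
  (path_deliv n <= T)%R%:R * dr (s n.+1) (path_age n) (b n) (y n.+1).
Proof. by rewrite /path_drift big_ord_recr. Qed.

(** A sum of nonnegative terms that dominates both the coefficient [delta^-1 + 1] of the squared
    overshoot and the constants left by the completed squares in [path_drift_lower]. *)
Definition lower_cst (delta : R) : R :=
  delta^-1 + 1 + c ^+ 2 / delta + c ^+ 2 + `|K| + theta ^+ 2 + beta ^+ 2.

Lemma lower_cst_ge0 (delta : R) : 0 < delta -> 0 <= lower_cst delta.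
Proof.
move=> d0; have dV0 : 0 <= delta^-1 by rewrite invr_ge0 ltW.
rewrite /lower_cst !addr_ge0 ?sqr_ge0 ?normr_ge0// divr_ge0 ?sqr_ge0//.
exact: ltW.
Qed.

(* The terminal terms are of order [A * y], with [A] the age at time [T]; they are
   absorbed by the cost because the age has slope one, so [A ^ 2 / 2 <= path_cost T n]. *)
Lemma path_drift_lower (delta : R) n : 0 < delta -> T < path_deliv n ->
  path_drift (fun i => path_age i + Num.min (z i) (T - path_deliv i)) n <=
  (1 + delta) * path_cost T n - beta * T +
  lower_cst delta * (1 + path_over T n)
  - K.
Proof.
have c0' := c0; have theta0' := theta0; have T0' := T0.
move=> d0; set C := lower_cst delta.
have dV0 : 0 < delta^-1 by rewrite invr_gt0.
have C0 : 0 <= C by exact: lower_cst_ge0.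
(* Up to [T] the drifts telescope exactly; the straddling slot produces the whole error; later slots
   carry a zero indicator. The bound on [path_age n' ^ 2 / 2] rides along to make the age at [T]
   payable by the cost. *)
suff H n' : (path_deliv n' <= T ->
       path_drift (fun i => path_age i + Num.min (z i) (T - path_deliv i)) n' =
         path_cost T n' - beta * path_deliv n' + rv (path_age n') - K /\
       path_age n' ^+ 2 / 2 <= path_cost T n') /\
     (T < path_deliv n' -> path_drift (fun i => path_age i + Num.min (z i) (T - path_deliv i)) n' <=
        (1 + delta) * path_cost T n' - beta * T + C * (1 + path_over T n') - K).
  exact: (H n).2.
elim: n' => [|i [IH1 IH2]].
  split => [_|/=]; last by rewrite ltNge T0.
  rewrite /path_drift /path_cost !big_ord0 /path_age/= subrr relval0// expr0n/=; split; lra.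
rewrite path_driftS path_costS path_overS.
have [DiT|TDi] := leP (path_deliv i) T; last first.
  have TDi1 : T < path_deliv i.+1 by exact: lt_le_trans TDi (path_delivS i).
  split; first by rewrite leNgt TDi1.
  by move=> _; rewrite !mul0r !addr0; exact: IH2.
have {IH1}[E1 E2] := IH1 DiT.
rewrite E1.
have a0 := path_age_ge0 i; have zi := z0 i; have y0 := y_ge0 i.
split=> [DT|TD].
  have zT : Num.min (z i) (T - path_deliv i) = z i.
    by apply: minr_idl; move: DT => /=; lra.
  rewrite zT (_ : Num.min _ T = path_deliv i.+1); last exact: minr_idl.
  rewrite !mul1r.
  have bE : path_age i + z i + y i.+1 = path_deliv i.+1 - path_last i by rewrite /path_age/=; ring.
  split.
    rewrite /drift -path_ageS bE; move: bE; rewrite /path_age/=; lra.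
  apply: (@le_trans _ _ ((path_deliv i.+1 - path_last i) ^+ 2 / 2)); last by move: E2; lra.
  rewrite ler_pM2r ?invr_gt0//; apply: lerXn2r; rewrite ?nnegrE ?path_age_ge0//.
    by rewrite subr_ge0; apply: le_trans (path_lastS i) (path_last_le _).
  by rewrite /path_age lerB// path_lastS.
rewrite (lt_geF TD)/= !mul1r.
rewrite (_ : Num.min _ T = T); last by apply: minr_idr; exact: ltW.
set w := Num.min _ _; set Y := y i.+1; set A := T - path_last i.
rewrite -/Y in y0.
have w1 : w <= T - path_deliv i by rewrite ge_min lexx orbT.
have w0 : 0 <= w by rewrite le_min zi/= subr_ge0.
(* The cut wait [w] still brings the end of the slot to [T] or later, while the age at sampling
   stays below the age [A] at time [T]. *)
have Tw : T <= path_deliv i + w + Y.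
  rewrite /w; have [h|h] := leP (z i) (T - path_deliv i); last by lra.
  by move: TD => /=; rewrite -/Y; lra.
have AE : A = T - path_deliv i + path_age i by rewrite /A /path_age; ring.
have A0 : 0 <= A by lra.
have bA : path_age i + w <= A by lra.
have IA : A ^+ 2 / 2 <= path_cost T i + (A ^+ 2 - path_age i ^+ 2) / 2 by lra.
set I := path_cost T i + _ in IA *.
have R0 := path_over_ge0 T i.
rewrite /drift.
set a' := if _ then _ else _.
have a'0 : 0 <= a' by rewrite /a'; case: ifP => _; lra.
have a'A : a' <= A + Y by rewrite /a'; case: ifP => _; lra.
have h' := relval_le theta K c0 a'0.
have bY : (path_age i + w + Y) ^+ 2 <= (A + Y) ^+ 2.
  by apply: lerXn2r; rewrite ?nnegrE; lra.
have bT : beta * T <= beta * (path_deliv i + w + Y).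
  by apply: ler_wpM2l => //; lra.
have cA : c * a' <= c * A + c * Y.
  by rewrite -mulrDr; apply: ler_wpM2l.
(* Young's inequality, here and for [c * A] below, with weights such that the two uses together cost
   [delta * (A ^ 2 / 2)]. *)
have AY : A * Y <= delta / 2 * (A ^+ 2 / 2) + Y ^+ 2 / delta.
  have : 0 <= (delta / 2 * A - Y) ^+ 2 / delta by rewrite divr_ge0 ?sqr_ge0// ltW.
  rewrite (_ : (_ ^+ 2) / delta = delta / 2 * (A ^+ 2 / 2) - A * Y + Y ^+ 2 / delta).
    lra.
  by field; rewrite gt_eqF.
have cAY : c * A <= delta / 2 * (A ^+ 2 / 2) + c ^+ 2 / delta.
  have : 0 <= (delta / 2 * A - c) ^+ 2 / delta by rewrite divr_ge0 ?sqr_ge0// ltW.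
  rewrite (_ : (_ ^+ 2) / delta = delta / 2 * (A ^+ 2 / 2) - c * A + c ^+ 2 / delta).
    lra.
  by field; rewrite gt_eqF.
have cY : c * Y <= c ^+ 2 / 2 + Y ^+ 2 / 2.
  by have := sqr_ge0 (c - Y); rewrite !expr2; lra.
have dI : delta * (A ^+ 2 / 2) <= delta * I by rewrite ler_pM2l.
have CR : 0 <= C * path_over T i by apply: mulr_ge0.
have CY : (delta^-1 + 1) * Y ^+ 2 <= C * Y ^+ 2.
  apply: ler_wpM2r; first exact: sqr_ge0.
  rewrite /C /lower_cst; have := sqr_ge0 c; have := sqr_ge0 theta; have := sqr_ge0 beta.
  have := normr_ge0 K; have : 0 <= c ^+ 2 / delta by rewrite divr_ge0 ?sqr_ge0// ltW.
  lra.
have C1 : c ^+ 2 / delta + c ^+ 2 / 2 + K + theta ^+ 2 / 2 + beta ^+ 2 / 2 <= C.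
  rewrite /C /lower_cst; have := sqr_ge0 c; have := sqr_ge0 theta; have := sqr_ge0 beta.
  have := ler_norm K; lra.
have IE : I = path_cost T i + (A ^+ 2 - path_age i ^+ 2) / 2 by [].
rewrite (mulrDr C) mulr1 (mulrDr C).
rewrite (mulrDl _ _ I) mul1r.
have sE : (A + Y) ^+ 2 = A ^+ 2 + 2 * (A * Y) + Y ^+ 2 by ring.
have dE : (delta^-1 + 1) * Y ^+ 2 = Y ^+ 2 / delta + Y ^+ 2 by rewrite mulrDl mul1r mulrC.
have dE2 : delta / 2 * (A ^+ 2 / 2) = delta * (A ^+ 2 / 2) / 2 by ring.
have bE2 : beta * (path_age i + w - path_age i + Y) =
  beta * (path_deliv i + w + Y) - beta * path_deliv i by ring.
rewrite bE2; move: E2; rewrite -/(rv _); lra.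
Qed.

(** The threshold wait is at most [theta], so the straddling slot ends before [T + theta + Y], and
    [Y <= 1 + Y ^ 2] turns this delay into [path_over]. The cost of that slot beyond [T] is only
    added, and its terminal value is at least [K]. *)
Lemma path_cost_upper n :
  (forall i, z i = Num.max (theta - path_age i) 0) -> T < path_deliv n ->
  path_cost T n <= path_drift (fun i => Num.max (path_age i) theta) n + beta * T
    + beta * (theta + 1 + path_over T n).
Proof.
have c0' := c0; have theta0' := theta0; have T0' := T0.
move=> zE.
suff H n' : (path_deliv n' <= T ->
       path_drift (fun i => Num.max (path_age i) theta) n' =
         path_cost T n' - beta * path_deliv n' + rv (path_age n') - K) /\
     (T < path_deliv n' -> path_cost T n' <=
       path_drift (fun i => Num.max (path_age i) theta) n' + beta * T
       + beta * (theta + 1 + path_over T n')).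
  exact: (H n).2.
elim: n' => [|i [IH1 IH2]].
  split => [_|/=]; last by rewrite ltNge T0.
  rewrite /path_drift /path_cost !big_ord0 /path_age/= subrr relval0//; lra.
rewrite path_driftS path_costS path_overS.
have [DiT|TDi] := leP (path_deliv i) T; last first.
  have TDi1 : T < path_deliv i.+1 by exact: lt_le_trans TDi (path_delivS i).
  split; first by rewrite leNgt TDi1.
  by move=> _; rewrite !mul0r !addr0; exact: IH2.
have {IH1}E1 := IH1 DiT.
rewrite E1.
have a0 := path_age_ge0 i; have zi := z0 i; have y0 := y_ge0 i.
have bE0 : Num.max (path_age i) theta = path_age i + z i.
  rewrite zE; have [h|h] := leP (path_age i) theta.
    by rewrite (_ : Num.max (theta - path_age i) 0 = theta - path_age i); [lra|apply: maxr_idl; lra].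
  by rewrite (_ : Num.max (theta - path_age i) 0 = 0); [lra|apply: maxr_idr; lra].
have ztheta : z i <= theta by rewrite zE ge_max theta0 andbT; lra.
have bE : path_age i + z i + y i.+1 = path_deliv i.+1 - path_last i by rewrite /path_age/=; ring.
rewrite bE0 !mul1r.
split=> [DT|TD].
  rewrite (_ : Num.min _ T = path_deliv i.+1); last exact: minr_idl.
  rewrite /drift -path_ageS bE; move: bE; rewrite /path_age/=; lra.
rewrite (lt_geF TD)/= !mul1r.
rewrite (_ : Num.min _ T = T); last by apply: minr_idr; exact: ltW.
set Y := y i.+1; set A := T - path_last i; rewrite -/Y in y0.
have A0 : 0 <= A by rewrite /A; have := path_last_le i; lra.
have AB : A ^+ 2 <= (path_deliv i.+1 - path_last i) ^+ 2.
  by move: A0; rewrite /A => A0; apply: lerXn2r; rewrite ?nnegrE; lra.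
rewrite /drift; set a' := if _ then _ else _.
have a'0 : 0 <= a' by rewrite /a'; case: ifP => _; lra.
have h' := relval_ge K c0 theta0 a'0.
have R0 := path_over_ge0 T i.
have YY : Y <= 1 + Y ^+ 2 by have := sqr_ge0 (Y - 1); have := sqr_ge0 Y; rewrite !expr2; lra.
have b0 : 0 <= beta by lra.
have B1 : beta * (path_deliv i + z i + Y) <= beta * (T + theta + 1 + (path_over T i + Y ^+ 2)).
  by apply: ler_wpM2l => //; lra.
have bE2 : beta * (path_age i + z i - path_age i + Y) =
  beta * (path_deliv i + z i + Y) - beta * path_deliv i by ring.
have bE3 : beta * (T + theta + 1 + (path_over T i + Y ^+ 2)) =
  beta * T + beta * (theta + 1 + (path_over T i + Y ^+ 2)) by ring.
rewrite bE2; rewrite -/Y in bE; rewrite bE; move: AB h'; rewrite -/(rv _); lra.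
Qed.

End path.

Section path_ext.
Context {R : realType}.

Lemma path_deliv_ext (y y' zz : nat -> R) : (forall i, y i.+1 = y' i.+1) ->
  path_deliv y zz = path_deliv y' zz.
Proof. by move=> h; apply/funext; elim=> //= i ->; rewrite h. Qed.

Lemma path_last_ext (y y' zz : nat -> R) s : (forall i, y i.+1 = y' i.+1) ->
  path_last y zz s = path_last y' zz s.
Proof.
by move=> h; apply/funext; elim=> //= i ->; rewrite (path_deliv_ext zz h).
Qed.

Lemma path_cost_ext (y y' zz : nat -> R) s T n : (forall i, y i.+1 = y' i.+1) ->
  path_cost y zz s T n = path_cost y' zz s T n.
Proof. by move=> h; rewrite /path_cost /path_age (path_deliv_ext zz h) (path_last_ext zz s h). Qed.

End path_ext.

(** * Integral of the age along a path *)

Section integral_age.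
Context {R : realType}.
Notation mu := (@lebesgue_measure R).

Lemma integral_affine (L p q : R) : p <= q ->
  (\int[mu]_(t in `[p, q]) (t - L)%:E)%E = (((q - L) ^+ 2 - (p - L) ^+ 2) / 2)%:E.
Proof.
rewrite le_eqVlt => /predU1P[->|pq].
  by rewrite set_itv1 integral_set1 subrr mul0r.
pose F : R -> R := (2^-1 *: ((id - cst L) ^+ 2))%R.
have FE t : F t = (t - L) ^+ 2 / 2 by rewrite /F /= mulrC.
have dF (t : R) : is_derive t 1 F (t - L).
  rewrite /F; apply: is_derive_eq.
  have -> : (id - cst L : R -> R) t = t - L by [].
  by rewrite subr0 expr1 /GRing.scale/=; field.
have cF (t : R) : {for t, continuous F}.
  by apply: differentiable_continuous; apply/derivable1_diffP; have [] := dF t.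
rewrite (@continuous_FTC2 _ _ F)//.
- by rewrite !FE -EFinB mulrBl.
- apply: continuous_subspaceT => t.
  by apply: cvgB; [exact: cvg_id|exact: cvg_cst].
- split; first by move=> t _; have [] := dF t.
  + exact/cvg_at_right_filter/cF.
  + exact/cvg_at_left_filter/cF.
- by move=> t _; rewrite derive1E; have [_] := dF t.
Qed.

Context {d : measure_display} {Omega : measurableType d}.
Variables (Y : nat -> Omega -> R) (succ : nat -> Omega -> bool).
Variables (pi : policy (Omega := Omega) (R := R)) (w : Omega).
Local Notation y := (fun i => Y i w).
Local Notation z := (fun i => pol_Z pi i w).
Local Notation s := (fun i => succ i w).
Local Notation D := (path_deliv y z).
Local Notation L := (path_last y z s).

Lemma delivE i : deliv Y pi i w = D i.
Proof. by elim: i => //= i ->. Qed.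

Lemma sampE i : samp Y pi i.+1 w = D i + pol_Z pi i w.
Proof. by rewrite /= delivE. Qed.

Variable eps : R.
Hypotheses (eps0 : 0 < eps) (yeps : forall i, eps <= Y i.+1 w)
  (z0 : forall i, 0 <= pol_Z pi i w).

Let D_mono i j : (i <= j)%N -> D i <= D j.
Proof. exact: (@path_deliv_mono R y z eps eps0 yeps z0 i j). Qed.
Let D_S i : D i <= D i.+1.
Proof. exact: (@path_delivS R y z eps eps0 yeps z0 i). Qed.
Let D_ge i : i%:R * eps <= D i.
Proof. exact: (@path_deliv_ge R y z eps yeps z0 i). Qed.
Let L_S i : L i <= L i.+1.
Proof. exact: (@path_lastS R y z s eps eps0 yeps z0 i). Qed.

(** The samples delivered by time [t] are those of index at most [i], with the fictitious sample [0]
    among them; sampling times increase with the index, so the supremum is attained at the last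
    success. *)
Lemma age_eq i t : D i <= t -> t < D i.+1 -> age Y succ pi t w = t - L i.
Proof.
move=> Dit tDi; rewrite /age; congr (_ - _).
set A := [set _ | _ in _].
have AL : A (L i).
  suff [k [ki dk sk]] : exists k, [/\ (k <= i)%N, delivered succ k w & samp Y pi k w = L i].
    exists k => //=; split => //; rewrite delivE.
    exact: le_trans (D_mono ki) Dit.
  elim: i {Dit tDi A} => [|i [k [ki dk sk]]]; first by exists 0%N.
  rewrite /path_last -/(L i); case: ifPn => si.
    by exists i.+1; split => //; rewrite ?sampE// /delivered si orbT.
  by exists k; split => //; exact: leqW.
have ubA : ubound A (L i).
  move=> _ [k [dk Dk] <-]; rewrite delivE in Dk.
  have ki : (k <= i)%N.
    rewrite leqNgt; apply/negP => /D_mono h.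
    by have := le_lt_trans (le_trans h Dk) tDi; rewrite ltxx.
  elim: i {Dit tDi A AL} ki => [|i IH]; first by rewrite leqn0 => /eqP -> /=.
  rewrite leq_eqVlt ltnS => /predU1P[kE|/IH h].
    rewrite kE sampE /path_last; move: dk; rewrite /delivered kE /= => ->; exact: lexx.
  exact: le_trans h (L_S i).
apply/eqP; rewrite eq_le; apply/andP; split.
- by apply: ge_sup => //; exists (L i).
- by apply: ub_le_sup => //; exists (L i).
Qed.

Lemma integral_age (T : R) n : 0 <= T -> T < D n ->
  (\int[mu]_(t in `[0%R, T]) (age Y succ pi t w)%:E)%E = (path_cost y z s T n)%:E.
Proof.
move=> T0 TDn.
pose x i := Num.min (D i) T.
have x0 i : 0 <= x i.
  rewrite /x le_min T0 andbT; apply: le_trans (D_ge i).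
  by rewrite mulr_ge0// ltW.
have xS i : x i <= x i.+1.
  rewrite /x le_min !ge_min lexx orbT andbT.
  by rewrite D_S.
(* Splitting the integral requires measurability of the age, which is therefore proved in the same
   induction. The intervals are half-open because the age may jump at a delivery. *)
suff [mT IT] : measurable_fun `[0, x n[ (fun t => (age Y succ pi t w)%:E) /\
    (\int[mu]_(t in `[0%R, x n[) (age Y succ pi t w)%:E)%E = (path_cost y z s T n)%:E.
  move: mT IT; rewrite /x minr_idr ?(ltW TDn)// => mT <-.
  by rewrite integral_itv_bndo_bndc.
elim: n {TDn} => [|i [mi Ii]].
  rewrite /x /= minr_idl// set_itv_ge ?bnd_simp ?ltxx//.
  split; first exact: measurable_fun_set0.
  by rewrite integral_set0 /path_cost big_ord0.
rewrite path_costS; have [DT|TD] := leP (D i) T; last first.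
  have E j : D i <= D j -> x j = T.
    by move=> h; rewrite /x minr_idr// (le_trans _ h)// ltW.
  rewrite (E i.+1); last exact: D_S i.
  by move: mi Ii; rewrite (E i)// mul0r addr0.
have xiE : x i = D i by rewrite /x minr_idl.
have ageE t : `[x i, x i.+1[%classic t -> age Y succ pi t w = t - L i.
  rewrite /= in_itv/= xiE => /andP[h1 h2]; apply: age_eq => //.
  by apply: lt_le_trans h2 _; rewrite ge_min lexx.
have m2 : measurable_fun `[x i, x i.+1[ (fun t => (t - L i)%:E).
  by apply/measurable_EFinP; apply: measurable_funB.
have m1 : measurable_fun `[x i, x i.+1[ (fun t => (age Y succ pi t w)%:E).
  apply: eq_measurable_fun m2 => t; rewrite inE => h; by rewrite ageE.
have setE : `[0, x i.+1[%classic = `[0, x i[%classic `|` `[x i, x i.+1[%classic.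
  by rewrite -itv_bndbnd_setU// bnd_simp.
have mU : measurable_fun `[0, x i.+1[ (fun t => (age Y succ pi t w)%:E).
  by rewrite setE; apply/measurable_funU.
split => //; rewrite setE integral_setU//.
- have -> : (\int[mu]_(t in `[x i, x i.+1[) (age Y succ pi t w)%:E =
            \int[mu]_(t in `[x i, x i.+1[) (t - L i)%:E)%E.
    by apply: eq_integral => t; rewrite inE => h; rewrite ageE.
  rewrite Ii integral_itv_bndo_bndc// integral_affine// xiE -EFinD.
  by congr EFin; rewrite mul1r /path_age.
- by rewrite -setE.
- apply/disj_setPS => t [/=]; rewrite !in_itv/= => /andP[_ h1] /andP[h2 _].
  by have := lt_le_trans h1 h2; rewrite ltxx.
Qed.

End integral_age.

(** * Means, laws and measurability with respect to the history *)

Section mean.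
Context {d : measure_display} {Omega : measurableType d} {R : realType}.
Variable P : probability Omega R.
Implicit Types (f g : Omega -> R) (a b k : R).

(** Integrability and value are bundled so that a single derivation carries both through linear
    combinations and independent products. *)
Definition mean f a : Prop :=
  P.-integrable setT (EFin \o f) /\ \int[P]_w f w = a.

Lemma mean_ext f g a : f =1 g -> mean f a -> mean g a.
Proof. by move=> /funext ->. Qed.

Lemma mean_integral f a : mean f a -> (\int[P]_w (f w)%:E)%E = a%:E.
Proof. by move=> [i <-]; rewrite /Rintegral fineK// integrable_fin_num. Qed.

Lemma integrable_mean f : P.-integrable setT (EFin \o f) ->
  mean f (\int[P]_w f w).
Proof. by []. Qed.

Lemma meanD f g a b : mean f a -> mean g b -> mean (fun w => f w + g w) (a + b).
Proof.
move=> [fi <-] [gi <-]; split; last by rewrite RintegralD.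
exact: (integrableD measurableT fi gi).
Qed.

Lemma meanZ k f a : mean f a -> mean (fun w => k * f w) (k * a).
Proof.
move=> [fi <-]; split; last by rewrite RintegralZl.
exact: (integrableZl measurableT k fi).
Qed.

Lemma meanB f g a b : mean f a -> mean g b -> mean (fun w => f w - g w) (a - b).
Proof.
move=> fi gi; apply: (@mean_ext (fun w => f w + (-1) * g w)); first by move=> w; rewrite mulN1r.
by rewrite -(mulN1r b); apply: meanD => //; exact: meanZ.
Qed.

Lemma mean_cst k : mean (fun=> k) k.
Proof.
split; first exact: finite_measure_integrable_cst.
by rewrite Rintegral_cst// -[X in _ * X]/(fine (P setT)) probability_setT mulr1.
Qed.

Lemma mean_sum n (f : nat -> Omega -> R) (a : nat -> R) :
  (forall i, (i < n)%N -> mean (f i) (a i)) ->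
  mean (fun w => \sum_(i < n) f i w) (\sum_(i < n) a i).
Proof.
elim: n => [|n IH] h.
  by rewrite big_ord0; apply: mean_ext (mean_cst 0) => w; rewrite big_ord0.
rewrite big_ord_recr/=.
apply: (@mean_ext (fun w => \sum_(i < n) f i w + f n w)).
  by move=> w; rewrite big_ord_recr.
by apply: meanD; [apply: IH => i ni; apply: h; exact: ltnW|exact: h].
Qed.

Lemma mean_le f g a b : mean f a -> mean g b -> (forall w, f w <= g w) -> a <= b.
Proof. by move=> [fi <-] [gi <-] fg; exact: le_Rintegral. Qed.

Lemma mean_ae f g a : mean f a -> measurable_fun setT g ->
  {ae P, forall w, f w = g w} -> mean g a.
Proof.
move=> [fi <-] mg fg; have mf := measurable_int P fi.
have E : forall h : \bar R -> \bar R,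
  (\int[P]_w h (f w)%:E = \int[P]_w h (g w)%:E)%E.
  by move=> h; apply: eq_integral_ae; apply: filterS fg => w ->.
split; last by rewrite /Rintegral (E id).
apply/integrableP; split; first exact/measurable_EFinP.
by rewrite -(E abse); move/integrableP : fi => [].
Qed.

Lemma mean_le_ae f g a b : mean f a -> mean g b ->
  {ae P, forall w, f w <= g w} -> a <= b.
Proof.
move=> fi gi fg; rewrite -subr_ge0.
have h := meanB gi fi.
have : mean (fun w => Num.max (g w - f w) 0) (b - a).
  apply: (mean_ae h).
    apply: measurable_maxr => //.
    by have := measurable_int P h.1 => /measurable_EFinP.
  by apply: filterS fg => w fgw; rewrite maxr_idl// subr_ge0.
by move=> /(mean_le (mean_cst 0)); apply => w; rewrite le_max lexx orbT.
Qed.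

Lemma mean_bounded f (M : R) : measurable_fun setT f ->
  (forall w, `|f w| <= M) -> mean f (\int[P]_w f w).
Proof.
move=> mf fM; apply: integrable_mean.
apply: (@le_integrable _ _ _ _ _ measurableT _ (EFin \o cst M)).
- exact/measurable_EFinP.
- move=> w _ /=; rewrite lee_fin; apply: le_trans (fM w) _; exact: ler_norm.
- exact: finite_measure_integrable_cst.
Qed.

Lemma mean_dominated f g a : mean g a -> measurable_fun setT f ->
  (forall w, `|f w| <= g w) -> mean f (\int[P]_w f w).
Proof.
move=> gi mf fM; apply: integrable_mean.
apply: (@le_integrable _ _ _ _ _ measurableT _ (EFin \o g)).
- exact/measurable_EFinP.
- by move=> w _ /=; rewrite lee_fin (le_trans (fM w))// ler_norm.
- by case: gi.
Qed.

Lemma mean_measurable f a : mean f a -> measurable_fun setT f.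
Proof. by move=> [/(measurable_int P) /measurable_EFinP]. Qed.

Lemma mean_unique f a b : mean f a -> mean f b -> a = b.
Proof. by move=> [_ <-] [_ <-]. Qed.

Lemma meanM_indep (F G : set (set Omega)) f g a b :
  F `<=` measurable -> G `<=` measurable -> indep_sigma P F G ->
  measurable_wrt F f -> measurable_wrt G g ->
  mean f a -> mean g b -> mean (fun w => f w * g w) (a * b).
Proof.
move=> mF mG ind Ff Gg fi gi.
have [] := @indep_integral _ _ _ P f g (mean_measurable fi) (mean_measurable gi).
- by move=> A B mA mB; apply: ind; [exact: Ff|exact: Gg].
- by case: fi.
- by case: gi.
- by move=> ifg E; split => //; rewrite E; case: fi => _ ->; case: gi => _ ->.
Qed.

End mean.

Section law.
Context {d d' : measure_display} {Omega : measurableType d} {Omega' : measurableType d'}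
  {R : realType}.
Variables (P : probability Omega R) (P' : probability Omega' R).

Lemma law_eq_ge0_integral (X : Omega -> R) (X' : Omega' -> R) (g : R -> \bar R) :
  measurable_fun setT X -> measurable_fun setT X' -> law_eq P P' X X' ->
  measurable_fun setT g -> (forall x, 0 <= g x)%E ->
  (\int[P]_w g (X w) = \int[P']_w g (X' w))%E.
Proof.
move=> mX mX' e mg g0.
pose XX : {mfun Omega >-> R} := HB.pack X (isMeasurableFun.Build _ _ _ _ _ mX).
pose XX' : {mfun Omega' >-> R} := HB.pack X' (isMeasurableFun.Build _ _ _ _ _ mX').
rewrite -[LHS](@ge0_integral_distribution _ _ _ _ _ P XX g)//.
rewrite -[RHS](@ge0_integral_distribution _ _ _ _ _ P' XX' g)//.
by apply: eq_measure_integral => A mA _; exact: e.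
Qed.

Lemma law_eq_mean (X : Omega -> R) (X' : Omega' -> R) (g : R -> R) a :
  measurable_fun setT X -> measurable_fun setT X' -> law_eq P P' X X' ->
  measurable_fun setT g -> mean P (fun w => g (X w)) a ->
  mean P' (fun w => g (X' w)) a.
Proof.
move=> mX mX' e mg [ig ga].
have mEg : measurable_fun setT (EFin \o g) by exact/measurable_EFinP.
have E1 : (\int[P]_w (g (X w))%:E = \int[P']_w (g (X' w))%:E)%E.
  rewrite integralE [RHS]integralE; congr (_ - _)%E.
  - have := @law_eq_ge0_integral X X' ((EFin \o g)^\+)%E mX mX' e.
    rewrite (_ : (fun w => ((EFin \o g)^\+)%E (X w)) = (fun w => (g (X w))%:E)^\+%E); last first.
      by apply/funext => w; rewrite !funeposE.
    rewrite (_ : (fun w => ((EFin \o g)^\+)%E (X' w)) = (fun w => (g (X' w))%:E)^\+%E); last first.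
      by apply/funext => w; rewrite !funeposE.
    by apply => //; exact: measurable_funepos.
  - have := @law_eq_ge0_integral X X' ((EFin \o g)^\-)%E mX mX' e.
    rewrite (_ : (fun w => ((EFin \o g)^\-)%E (X w)) = (fun w => (g (X w))%:E)^\-%E); last first.
      by apply/funext => w; rewrite !funenegE.
    rewrite (_ : (fun w => ((EFin \o g)^\-)%E (X' w)) = (fun w => (g (X' w))%:E)^\-%E); last first.
      by apply/funext => w; rewrite !funenegE.
    by apply => //; exact: measurable_funeneg.
split; last by rewrite /Rintegral -E1.
apply/integrableP; split; first by apply/measurable_EFinP; exact: measurableT_comp.
move/integrableP : ig => [_].
rewrite (law_eq_ge0_integral mX mX' e (g := fun x => `|(g x)%:E|%E))//.
exact: measurableT_comp.
Qed.

Lemma law_eq_ae (X : Omega -> R) (X' : Omega' -> R) (A : set R) :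
  measurable_fun setT X -> measurable_fun setT X' -> law_eq P P' X X' ->
  measurable A -> {ae P, forall w, A (X w)} -> {ae P', forall w, A (X' w)}.
Proof.
move=> mX mX' e mA [N [mN N0 sub]].
have mC : measurable (X' @^-1` (~` A)).
  by rewrite -[_ @^-1` _]setTI; apply: mX' => //; exact: measurableC.
have mC' : measurable (X @^-1` (~` A)).
  by rewrite -[_ @^-1` _]setTI; apply: mX => //; exact: measurableC.
exists (X' @^-1` (~` A)); split => //.
rewrite -(e (~` A) (measurableC mA)).
by apply: (subset_measure0 (B := N)).
Qed.

End law.

Section measurable_wrt.
Context {d : measure_display} {Omega : measurableType d} {R : realType}.
Variable (G : set (set Omega)).
Implicit Types f g : Omega -> R.
Local Notation mw := (measurable_wrt <<s G >>).

(** Equipping [Omega] with the sigma-algebra generated by [G] makes this ordinary measurability,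
    from which the closure properties below are inherited. *)
Lemma measurable_wrtP f :
  mw f <-> measurable_fun setT (f : g_sigma_algebraType G -> R).
Proof.
split=> [h _ B mB|h B mB]; first by rewrite setTI; exact: h.
by have := h measurableT B mB; rewrite setTI.
Qed.

Lemma wrt_cst (k : R) : mw (fun=> k).
Proof. by apply/measurable_wrtP. Qed.

Lemma wrtD f g : mw f -> mw g -> mw (fun w => f w + g w).
Proof.
move=> /measurable_wrtP hf /measurable_wrtP hg; apply/measurable_wrtP.
exact: measurable_funD.
Qed.

Lemma wrtM f g : mw f -> mw g -> mw (fun w => f w * g w).
Proof.
move=> /measurable_wrtP hf /measurable_wrtP hg; apply/measurable_wrtP.
exact: measurable_funM.
Qed.

Lemma wrtB f g : mw f -> mw g -> mw (fun w => f w - g w).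
Proof.
move=> /measurable_wrtP hf /measurable_wrtP hg; apply/measurable_wrtP.
exact: measurable_funB.
Qed.

Lemma wrt_max f g : mw f -> mw g -> mw (fun w => Num.max (f w) (g w)).
Proof.
move=> /measurable_wrtP hf /measurable_wrtP hg; apply/measurable_wrtP.
exact: measurable_maxr.
Qed.

Lemma wrt_min f g : mw f -> mw g -> mw (fun w => Num.min (f w) (g w)).
Proof.
move=> /measurable_wrtP hf /measurable_wrtP hg; apply/measurable_wrtP.
exact: measurable_minr.
Qed.

Lemma wrtX f n : mw f -> mw (fun w => f w ^+ n).
Proof. by move=> /measurable_wrtP hf; apply/measurable_wrtP; exact: measurable_funX. Qed.

Lemma wrt_le f g : mw f -> mw g -> mw (fun w => (f w <= g w)%R%:R : R).
Proof.
move=> /measurable_wrtP hf /measurable_wrtP hg; apply/measurable_wrtP.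
rewrite [X in measurable_fun _ X](_ : _ = fun w => if f w <= g w then 1 else 0); last first.
  by apply/funext => w; case: (f w <= g w).
by apply: measurable_fun_ifT => //; exact: measurable_fun_ler.
Qed.

Lemma wrt_comp (h : R -> R) f : measurable_fun setT h -> mw f -> mw (fun w => h (f w)).
Proof. by move=> mh /measurable_wrtP hf; apply/measurable_wrtP; exact: measurableT_comp. Qed.

Lemma wrt_sum n (f : nat -> Omega -> R) : (forall i, (i < n)%N -> mw (f i)) ->
  mw (fun w => \sum_(i < n) f i w).
Proof.
move=> h; elim: n h => [|n IH] h.
  rewrite (_ : (fun w => _) = fun=> 0); first exact: wrt_cst.
  by apply/funext => w; rewrite big_ord0.
rewrite (_ : (fun w => _) = fun w => \sum_(i < n) f i w + f n w); last first.
  by apply/funext => w; rewrite big_ord_recr.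
by apply: wrtD; [apply: IH => i ni; apply: h; exact: ltnW|exact: h].
Qed.

End measurable_wrt.

Section sigma_gen.
Context {d : measure_display} {Omega : measurableType d} {R : realType}.
Implicit Types (Xs Ys : set (Omega -> R)).

Lemma sigma_genS Xs Ys : Xs `<=` Ys -> sigma_gen Xs `<=` sigma_gen Ys.
Proof.
move=> XY; apply: smallest_sub; first exact: smallest_sigma_algebra.
by move=> A [X XX hA]; apply: sub_sigma_algebra; exists X => //; exact: XY.
Qed.

Lemma sigma_gen_measurable Xs : (forall X, Xs X -> measurable_fun setT X) ->
  sigma_gen Xs `<=` measurable.
Proof.
move=> mX; apply: smallest_sub; first exact: sigma_algebra_measurable.
move=> _ [X XX [B mB ->]]; rewrite -[_ @^-1` _]setTI; exact: mX.
Qed.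

Lemma sigma_gen_in Xs X : Xs X -> measurable_wrt (sigma_gen Xs) X.
Proof.
by move=> XX B mB; apply: sub_sigma_algebra; exists X => //; exists B.
Qed.

Lemma measurable_wrtS (F G : set (set Omega)) (X : Omega -> R) :
  F `<=` G -> measurable_wrt F X -> measurable_wrt G X.
Proof. by move=> FG h B mB; apply: FG; exact: h. Qed.

Lemma measurable_wrt_fun (F : set (set Omega)) (X : Omega -> R) :
  F `<=` measurable -> measurable_wrt F X -> measurable_fun setT X.
Proof. by move=> mF h _ B mB; rewrite setTI; apply: mF; exact: h. Qed.

End sigma_gen.

(** * Bounds on the average age of a policy *)

Section system.
Context {d : measure_display} {Omega : measurableType d} {R : realType}.
Variables (P : probability Omega R) (alpha eps : R).
Variables (Y : nat -> Omega -> R) (succ : nat -> Omega -> bool).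
Hypotheses (alpha01 : 0 <= alpha < 1) (eps0 : 0 < eps).
Hypothesis mY : forall i, measurable_fun setT (Y i).
Hypothesis msucc : forall i, measurable_fun setT (@succR _ _ R succ i).
Hypothesis indepY : mutually_independent P (sys_family Y succ).
Hypothesis lawY : forall i, (1 <= i)%N -> law_eq P P (Y i) (Y 1%N).
Hypothesis Psucc : forall i, (1 <= i)%N -> P [set w | succ i w] = (1 - alpha)%:E.
Hypothesis Yeps : {ae P, forall w, eps <= Y 1%N w}.
Hypothesis Y2 : ('E_P[fun w => (Y 1%N w ^+ 2)%R] < +oo)%E.

(* clamping at [eps] changes [Y i] only on a null set and makes every path regular *)
Definition Yc (i : nat) (w : Omega) : R := Num.max (Y i w) eps.

Lemma Yc_ge i w : eps <= Yc i w.
Proof. by rewrite /Yc le_max lexx orbT. Qed.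

Lemma measurable_Yc i : measurable_fun setT (Yc i).
Proof. exact: measurable_maxr. Qed.

Lemma Yc_ae : {ae P, forall w, forall i, Yc i.+1 w = Y i.+1 w}.
Proof.
apply: ae_foralln => i.
have : {ae P, forall w, `[eps, +oo[%classic (Y i.+1 w)}.
  apply: (@law_eq_ae _ _ _ _ _ P P (Y 1%N)) => //.
    by move=> B mB; rewrite lawY.
  by apply: filterS Yeps => w; rewrite /= in_itv/= andbT.
by apply: filterS => w; rewrite /= in_itv/= andbT => h; rewrite /Yc maxr_idl.
Qed.

Lemma measurable_sys x : measurable_fun setT (sys_family Y succ x).
Proof. by case: x => k /=. Qed.

Lemma Yc_mean (g : R -> R) a i : measurable_fun setT g ->
  mean P (fun w => g (Yc 1%N w)) a -> mean P (fun w => g (Yc i.+1 w)) a.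
Proof.
move=> mg; apply: (@law_eq_mean _ _ _ _ _ P P (Y 1%N) (Y i.+1) (fun x => g (Num.max x eps))) => //.
  by move=> B mB; rewrite lawY.
by apply: measurableT_comp => //; exact: measurable_maxr.
Qed.

Definition EYsq : R := \int[P]_w (Yc 1%N w ^+ 2).
Definition EY : R := \int[P]_w (Yc 1%N w).

Lemma mean_Ysq : mean P (fun w => Yc 1%N w ^+ 2) EYsq.
Proof.
apply: integrable_mean.
have iY : P.-integrable setT (EFin \o (fun w => Y 1%N w ^+ 2)).
  apply/integrableP; split; first by apply/measurable_EFinP; exact: measurable_funX.
  move: Y2; rewrite unlock; apply: le_lt_trans.
  apply: ge0_le_integral => //.
  - by apply: measurableT_comp => //; apply/measurable_EFinP; exact: measurable_funX.
  - by apply/measurable_EFinP; exact: measurable_funX.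
  - by move=> w _ /=; rewrite ger0_norm ?sqr_ge0.
have [] : mean P (fun w => Yc 1%N w ^+ 2) (\int[P]_w (Y 1%N w ^+ 2)).
  apply: (mean_ae (integrable_mean iY)).
    by apply: measurable_funX; exact: measurable_Yc.
  by apply: filterS Yc_ae => w ->.
by [].
Qed.

Lemma mean_Y : mean P (Yc 1%N) EY.
Proof.
apply: (mean_dominated (meanD (mean_cst P 1) mean_Ysq)); first exact: measurable_Yc.
move=> w; rewrite ger0_norm; last exact: le_trans (ltW eps0) (Yc_ge _ _).
by have := sqr_ge0 (Yc 1%N w - 1); have := sqr_ge0 (Yc 1%N w); rewrite !expr2; lra.
Qed.

Lemma mean_Yraw : mean P (Y 1%N) EY.
Proof. by apply: (mean_ae mean_Y) => //; apply: filterS Yc_ae => w <-. Qed.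

Lemma cYE : cY P Y alpha = EY / (1 - alpha).
Proof.
by rewrite /cY unlock -[X in X / _ = _]/(\int[P]_w Y 1%N w)%R; case: mean_Yraw => _ ->.
Qed.

Lemma EY_gt0 : 0 < EY.
Proof.
apply: lt_le_trans eps0 _; apply: (mean_le (mean_cst P eps) mean_Y) => w; exact: Yc_ge.
Qed.

(** Nonnegativity of the variance, which is what makes the threshold nonnegative in
    [threshold_root_exists]. *)
Lemma EYsq_ge : EY ^+ 2 <= EYsq.
Proof.
have h : mean P (fun w => (Yc 1%N w - EY) ^+ 2) (EYsq - EY ^+ 2).
  apply: (@mean_ext _ _ _ P (fun w => Yc 1%N w ^+ 2 - (2 * EY) * Yc 1%N w + EY ^+ 2)).
    by move=> w; ring.
  rewrite (_ : EYsq - _ = EYsq - 2 * EY * EY + EY ^+ 2); last by ring.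
  apply: meanD; last exact: mean_cst.
  by apply: meanB; [exact: mean_Ysq|apply: meanZ; exact: mean_Y].
rewrite -subr_ge0; apply: (mean_le (mean_cst P 0) h) => w; exact: sqr_ge0.
Qed.

Lemma succ_mean i : mean P (@succR _ _ R succ i.+1) (1 - alpha).
Proof.
have mA : measurable [set w | succ i.+1 w].
  rewrite (_ : [set w | _] = @succR _ _ R succ i.+1 @^-1` [set 1]).
    by rewrite -[_ @^-1` _]setTI; exact: msucc.
  apply/seteqP; split => w /=; rewrite /succR; first by move=> ->.
  by case: (succ i.+1 w) => // /eqP; rewrite eq_sym oner_eq0.
have E : @succR _ _ R succ i.+1 = \1_[set w | succ i.+1 w].
  apply/funext => w; rewrite /succR indicE; congr (_%:R).
  by case: (boolP (succ i.+1 w)) => h; [rewrite mem_set|rewrite memNset//; exact/negP].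
split.
  have [] := @mean_bounded _ _ _ P (@succR _ _ R succ i.+1) 1 (msucc _) _ => // w.
  by rewrite /succR ger0_norm ?ler0n// lern1 leq_b1.
by rewrite E /Rintegral integral_indic// setIT; exact: (congr1 fine (@Psucc i.+1 isT)).
Qed.

Definition hist_gen (U : Omega -> R) (i : nat) : set (Omega -> R) :=
  [set X | X = U \/ exists2 k, (1 <= k <= i)%N & (X = Y k \/ X = succR succ k)].

Definition step_gen (i : nat) : set (Omega -> R) :=
  [set X | X = Y i.+1 \/ X = succR succ i.+1].

(* [U] is adjoined to the system as the index [None] of one mutually independent family. *)
Lemma hist_indep U i : measurable_fun setT U ->
  indep_sigma P (sigma_gen [set U])
                (sigma_gen [set X | exists x, X = sys_family Y succ x]) ->
  indep_sigma P (sigma_gen (hist_gen U i)) (sigma_gen (step_gen i)).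
Proof.
move=> mU iU.
pose X (o : option (nat + nat)) := if o is Some x then sys_family Y succ x else U.
have mX o : measurable_fun setT (X o) by case: o => // x; exact: measurable_sys.
have miX : mutually_independent P X.
  move=> J B uJ mB.
  pose J' := pmap id J.
  have uJ' : uniq J'.
    apply: (@pmap_uniq _ _ id Some) => //; by move=> [].
  have memJ' x : (x \in J') = (Some x \in J) by rewrite mem_pmap map_id.
  have uS : uniq (map Some J') by rewrite map_inj_uniq//; move=> ? ? [].
  have memS o : (o \in map Some J') = (o != None) && (o \in J).
    case: o => [x|]; first by rewrite mem_map ?memJ'//; move=> ? ? [].
    by apply/negbTE/negP => /mapP[].
  pose S := \big[setI/setT]_(x <- J') (X (Some x) @^-1` B (Some x)).
  have PS : fine (P S) = \prod_(x <- J') fine (P (X (Some x) @^-1` B (Some x))).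
    exact: (indepY (J := J') (B := fun x => B (Some x))).
  (* Up to permutation, [J] is the list of its system indices, preceded by [None] when [U] occurs;
     in that case the factor of [U] splits off by the independence hypothesis on [U]. *)
  have [NJ|NJ] := boolP (None \in J); last first.
    have pJ : perm_eq J (map Some J').
      apply: uniq_perm => // o; rewrite memS; case: o => //; exact/negbTE.
    by rewrite !(perm_big _ pJ)/= !big_map.
  have pJ : perm_eq J (None :: map Some J').
    apply: uniq_perm => //; first by rewrite /= uS memS.
    by move=> o; rewrite inE memS; case: o => //=; rewrite NJ.
  rewrite !(perm_big _ pJ)/= !big_cons !big_map/= -/S -PS.
  rewrite iU ?fineM// ?fin_num_measure//.
  - by rewrite -[_ @^-1` _]setTI; exact: mU.
  - apply: bigsetI_measurable => x _; rewrite -[_ @^-1` _]setTI; exact: measurable_sys.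
  - by apply: sigma_gen_in.
  - rewrite /S; pose G := [set A | exists2 Z, [set X0 | exists x, X0 = sys_family Y succ x] Z &
                exists2 C : set R, measurable C & A = Z @^-1` C].
    apply: (@bigsetI_measurable _ (g_sigma_algebraType G)) => x _.
    apply: sub_sigma_algebra; exists (sys_family Y succ x); first by exists x.
    by exists (B (Some x)).
pose J1 : set (option (nat + nat)) := [set o | o = None \/
  exists2 k, (k < i)%N & (o = Some (inl k) \/ o = Some (inr k))].
pose J2 : set (option (nat + nat)) := [set o | o = Some (inl i) \/ o = Some (inr i)].
have J12 : J1 `&` J2 = set0.
  apply/seteqP; split => // o [] /= h [] E; move: h; rewrite E => -[//|[k ki]] [] [] // kE;
  by move: ki; rewrite -kE ltnn.
have H := mutually_independent_blocks mX miX J12.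
move=> A B hA hB; apply: H.
- apply: sigma_genS hA => Z [->|[[//|k] ki [->|->]]].
  + by exists None => //; left.
  + by exists (Some (inl k)) => //; right; exists k => //; left.
  + by exists (Some (inr k)) => //; right; exists k => //; right.
- apply: sigma_genS hB => Z [->|->].
  + by exists (Some (inl i)) => //; left.
  + by exists (Some (inr i)) => //; right.
Qed.

Lemma succ_Y_mean (g : R -> R) a i : measurable_fun setT g ->
  mean P (fun w => g (Yc 1%N w)) a ->
  mean P (fun w => @succR _ _ R succ i.+1 w * g (Yc i.+1 w)) ((1 - alpha) * a).
Proof.
move=> mg ga.
pose J1 : set (nat + nat) := [set inr i]; pose J2 : set (nat + nat) := [set inl i].
have J12 : J1 `&` J2 = set0 by apply/seteqP; split => // x /= [->].
have H := mutually_independent_blocks measurable_sys indepY J12.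
apply: (meanM_indep _ _ H).
- by apply: sigma_gen_measurable => X [x _ ->]; exact: measurable_sys.
- by apply: sigma_gen_measurable => X [x _ ->]; exact: measurable_sys.
- by apply: sigma_gen_in; exists (inr i).
- apply: (@wrt_comp _ _ _ _ (fun x => g (Num.max x eps)) (Y i.+1)).
    by apply: measurableT_comp => //; exact: measurable_maxr.
  by apply: sigma_gen_in; exists (inl i).
- exact: succ_mean.
- exact: Yc_mean.
Qed.

Definition tailm (Q : R) : R := \int[P]_w tail Q (Yc 1%N w).

Lemma measurable_tail Q : measurable_fun setT (@tail R Q).
Proof.
by apply: measurable_fun_ifT => //; exact: measurable_fun_ltr.
Qed.

Lemma tail_ge0 (Q x : R) : 0 <= tail Q x.
Proof. by rewrite /tail; case: ifP => // _; exact: sqr_ge0. Qed.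

Lemma mean_tail Q i : mean P (fun w => tail Q (Yc i.+1 w)) (tailm Q).
Proof.
apply: Yc_mean; first exact: measurable_tail.
apply: (mean_dominated mean_Ysq).
  by apply: measurableT_comp; [exact: measurable_tail|exact: measurable_Yc].
move=> w; rewrite ger0_norm ?tail_ge0// /tail; case: ifP => // _; exact: sqr_ge0.
Qed.

(** * Mean drift of an admissible policy and bounds at a finite horizon *)

Variables (c theta K : R).
Hypotheses (cE : c = EY / (1 - alpha)) (theta0 : 0 <= theta).
(** With [Y'] the sum of a geometric number of transmission times, the fraction is [E (Y' ^ 2)] and
    [c] is [E Y']. Then [K] equals [E ((theta + Y') ^ 2) / 2 - beta * E (theta + Y')], the value of
    a cycle started at age [0]. *)
Hypothesis KE : K = ((EYsq + 2 * alpha * c * EY) / (1 - alpha)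
                     - c ^+ 2 - (theta + c) ^+ 2) / 2.
Hypothesis relvalE : mean P (fun w => relval c theta K (Yc 1%N w)) 0.
Local Notation beta := (theta + c).

Lemma rho_gt0 : 0 < 1 - alpha.
Proof. by case/andP: alpha01; lra. Qed.

Lemma c_ge0 : 0 <= c.
Proof. by rewrite cE divr_ge0 ?(ltW EY_gt0) ?(ltW rho_gt0). Qed.

Lemma measurable_relval : measurable_fun setT (relval c theta K).
Proof.
rewrite /relval; apply: measurable_funD; last exact: measurable_funM.
apply: measurable_funB; last first.
  by apply: measurable_funM => //; exact: exprn_measurable.
apply: measurable_funD => //; apply: measurable_funM => //.
by apply: measurable_funX; apply: measurable_maxr => //; exact: measurable_funB.
Qed.

Variable pi : policy (Omega := Omega) (R := R).
Hypothesis piP : in_Pi P Y succ pi.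
Local Notation z w := (fun i => pol_Z pi i w).
Local Notation yc w := (fun i => Yc i w).
Local Notation sc w := (fun i => succ i w).
Local Notation Dw i w := (path_deliv (yc w) (z w) i).
Local Notation Lw i w := (path_last (yc w) (z w) (sc w) i).
Local Notation Aw i w := (path_age (yc w) (z w) (sc w) i).
Local Notation H i := (sigma_gen (hist_gen (pol_U pi) i)).
Local Notation N i := (sigma_gen (step_gen i)).

Lemma polU_measurable : measurable_fun setT (pol_U pi).
Proof. by case: piP. Qed.

Lemma polZ_ge0 i w : 0 <= pol_Z pi i w.
Proof. by case: piP. Qed.

Lemma H_measurable i : H i `<=` measurable.
Proof.
apply: sigma_gen_measurable => X [->|[k _ [->|->]]//]; exact: polU_measurable.
Qed.

Lemma N_measurable i : N i `<=` measurable.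
Proof. by apply: sigma_gen_measurable => X [->|->]. Qed.

Lemma H_S i : H i `<=` H i.+1.
Proof.
apply: sigma_genS => X [->|[k /andP[k1 ki] h]]; first by left.
by right; exists k => //; rewrite k1 leqW.
Qed.

Lemma Yc_wrt i : measurable_wrt (H i.+1) (Yc i.+1).
Proof.
apply: wrt_max; last exact: wrt_cst.
by apply: sigma_gen_in; right; exists i.+1 => //; [rewrite leqnn|left].
Qed.

Lemma succ_wrt i : measurable_wrt (H i.+1) (@succR _ _ R succ i.+1).
Proof.
by apply: sigma_gen_in; right; exists i.+1 => //; [rewrite leqnn|right].
Qed.

Lemma Z_wrt i : measurable_wrt (H i) (pol_Z pi i).
Proof. by case: piP => _ _ _ /(_ i). Qed.

Lemma D_wrt i : measurable_wrt (H i) (fun w => Dw i w).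
Proof.
elim: i => [|i IH]; first exact: wrt_cst.
apply: wrtD; last exact: Yc_wrt.
by apply: wrtD; apply: measurable_wrtS (@H_S i) _ => //; exact: Z_wrt.
Qed.

Lemma L_wrt i : measurable_wrt (H i) (fun w => Lw i w).
Proof.
elim: i => [|i IH]; first exact: wrt_cst.
rewrite (_ : (fun w => _) = fun w => succR succ i.+1 w * (Dw i w + pol_Z pi i w) +
   (1 - succR succ i.+1 w) * Lw i w); last first.
  by apply/funext => w /=; rewrite /succR; case: (succ i.+1 w) => /=; ring.
apply: wrtD; apply: wrtM; [exact: succ_wrt| |apply: wrtB; [exact: wrt_cst|exact: succ_wrt]|].
- apply: wrtD; apply: measurable_wrtS (@H_S i) _; [exact: D_wrt|exact: Z_wrt].
- exact: measurable_wrtS (@H_S i) _.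
Qed.

Lemma A_wrt i : measurable_wrt (H i) (fun w => Aw i w).
Proof. by apply: wrtB; [exact: D_wrt|exact: L_wrt]. Qed.

Lemma e_wrt T i : measurable_wrt (H i) (fun w => (Dw i w <= T)%R%:R : R).
Proof. by apply: wrt_le; [exact: D_wrt|exact: wrt_cst]. Qed.

(** Plays the part of conditioning on the history: a function of the past times a function of the
    next step. *)
Lemma step_mean i (X psi : Omega -> R) a b :
  measurable_wrt (H i) X -> measurable_wrt (N i) psi ->
  mean P X a -> mean P psi b -> mean P (fun w => X w * psi w) (a * b).
Proof.
move=> hX hpsi; apply: (meanM_indep (@H_measurable i) (@N_measurable i)) => //.
by apply: hist_indep; case: piP.
Qed.

(** In [drift_lb] the coefficients of [b ^ 2] and [b] have means [(1 - alpha) / 2] and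
    [- (1 - alpha) * theta], and [K] is the constant for which the free term has mean
    [(1 - alpha) / 2 * theta ^ 2]: the polynomial part completes to a square. The integrand on the
    right is nonnegative and vanishes for [b >= theta], which is the Bellman inequality with its
    equality case. *)
Lemma drift_lb_mean T i (b : Omega -> R) (M : R) : measurable_wrt (H i) b ->
  (forall w, Dw i w <= T -> 0 <= b w <= M) ->
  mean P (fun w => (Dw i w <= T)%R%:R * drift_lb c theta K (succ i.+1 w) (b w) (Yc i.+1 w))
    ((1 - alpha) / 2 * \int[P]_w ((Dw i w <= T)%R%:R *
       ((b w - theta) ^+ 2 - Num.max (b w - theta) 0 ^+ 2))).
Proof.
move=> hb bM; have th0 := theta0.
pose e w : R := (Dw i w <= T)%R%:R.
have he : measurable_wrt (H i) e by exact: e_wrt.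
pose X1 w := e w * b w; pose X2 w := e w * b w ^+ 2.
pose X3 w := e w * Num.max (b w - theta) 0 ^+ 2.
have hX1 : measurable_wrt (H i) X1 by apply: wrtM.
have hX2 : measurable_wrt (H i) X2 by apply: wrtM => //; exact: wrtX.
have hX3 : measurable_wrt (H i) X3.
  apply: wrtM => //; apply: wrtX; apply: wrt_max; last exact: wrt_cst.
  by apply: wrtB => //; exact: wrt_cst.
(* The indicator leaves a bounded, hence integrable, function. The bound used is [|C|], since [C]
   may be negative when the event [Dw i w <= T] is empty. *)
have bd (f : Omega -> R) (C : R) : measurable_wrt (H i) f ->
    (forall w, Dw i w <= T -> `|f w| <= C) ->
    mean P (fun w => e w * f w) (\int[P]_w (e w * f w)).
  move=> hf fC; apply: (@mean_bounded _ _ _ _ _ `|C|).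
    by apply: measurable_wrt_fun (@H_measurable i) _; exact: wrtM.
  move=> w; rewrite normrM /e; case: (boolP (Dw i w <= T)) => h; last by rewrite normr0 mul0r.
  by rewrite normr1 mul1r (le_trans (fC w h))// ler_norm.
have m0 : mean P e (\int[P]_w e w).
  have := bd (fun=> 1) 1 (@wrt_cst _ _ _ _ _) (fun _ _ => ltac:(by rewrite normr1)).
  by under eq_Rintegral do rewrite mulr1; apply: mean_ext => w; rewrite mulr1.
have m1 : mean P X1 (\int[P]_w X1 w).
  by apply: (bd b M) => // w /bM /andP[h1 h2]; rewrite ger0_norm.
have m2 : mean P X2 (\int[P]_w X2 w).
  apply: (bd _ (M ^+ 2)) => [|w /bM /andP[h1 h2]]; first exact: wrtX.
  by rewrite ger0_norm ?sqr_ge0//; apply: lerXn2r; rewrite ?nnegrE//; exact: le_trans h2.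
have m3 : mean P X3 (\int[P]_w X3 w).
  apply: (bd _ (M ^+ 2)) => [|w /bM /andP[h1 h2]].
    by apply: wrtX; apply: wrt_max; [apply: wrtB => //; exact: wrt_cst|exact: wrt_cst].
  rewrite ger0_norm ?sqr_ge0//; apply: lerXn2r; rewrite ?nnegrE ?le_max ?lexx ?orbT//.
    exact: le_trans h2.
  by rewrite ge_max; apply/andP; split; lra.
have hs : measurable_wrt (N i) (@succR _ _ R succ i.+1) by apply: sigma_gen_in; right.
have hy : measurable_wrt (N i) (Yc i.+1).
  by apply: wrt_max; [apply: sigma_gen_in; left|exact: wrt_cst].
have ms := succ_mean i.
have my : mean P (Yc i.+1) EY by apply: (@Yc_mean id) => //; exact: mean_Y.
have my2 : mean P (fun w => Yc i.+1 w ^+ 2) EYsq.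
  by apply: (@Yc_mean (fun x => x ^+ 2)); [exact: exprn_measurable|exact: mean_Ysq].
pose g x : R := - c * x - K + relval c theta K x.
have mg : measurable_fun setT g.
  apply: measurable_funD; last exact: measurable_relval.
  by apply: measurable_funB => //; exact: measurable_funM.
have mgY : mean P (fun w => g (Yc 1%N w)) (- c * EY - K + 0).
  apply: meanD => //; apply: meanB; last exact: mean_cst.
  by apply: meanZ; exact: mean_Y.
have msg := succ_Y_mean i mg mgY.
pose psi1 w := Yc i.+1 w - beta * succR succ i.+1 w.
have hpsi1 : measurable_wrt (N i) psi1.
  by apply: wrtB => //; apply: wrtM => //; exact: wrt_cst.
have mpsi1 : mean P psi1 (EY - beta * (1 - alpha)) by apply: meanB => //; exact: meanZ.
pose psi0 w := 2^-1 * Yc i.+1 w ^+ 2 - theta * Yc i.+1 w + succR succ i.+1 w * g (Yc i.+1 w).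
have hpsi0 : measurable_wrt (N i) psi0.
  apply: wrtD; last by apply: wrtM => //; exact: wrt_comp.
  apply: wrtB; apply: wrtM => //; try exact: wrt_cst.
  exact: wrtX.
have mpsi0 : mean P psi0 (2^-1 * EYsq - theta * EY + (1 - alpha) * (- c * EY - K + 0)).
  by apply: meanD => //; apply: meanB; exact: meanZ.
have t2 := meanZ 2^-1 (step_mean hX2 hs m2 ms).
have t1 := step_mean hX1 hpsi1 m1 mpsi1.
have t0 := step_mean he hpsi0 m0 mpsi0.
have t3 := meanZ 2^-1 (step_mean hX3 hs m3 ms).
have tot := meanB (meanD (meanD t2 t1) t0) t3.
have rhs : mean P (fun w => e w * ((b w - theta) ^+ 2 - Num.max (b w - theta) 0 ^+ 2))
   (\int[P]_w X2 w - 2 * theta * \int[P]_w X1 w + theta ^+ 2 * \int[P]_w e w - \int[P]_w X3 w).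
  have := meanB (meanD (meanB m2 (meanZ (2 * theta) m1)) (meanZ (theta ^+ 2) m0)) m3.
  by apply: mean_ext => w; rewrite /X1 /X2 /X3; ring.
case: rhs => _ ->.
have rho0 : 1 - alpha != 0 by rewrite gt_eqF// rho_gt0.
have cE' : EY = c * (1 - alpha) by rewrite cE divfK.
set v := (X in mean _ _ X) in tot.
rewrite [X in mean _ _ X](_ : _ = v).
  apply: mean_ext tot => w; rewrite /X1 /X2 /X3 /psi0 /psi1 /drift_lb /g /e.
  by rewrite /succR; field.
by rewrite /v KE cE'; field.
Qed.

Let y_eps w : forall i, eps <= yc w i.+1.
Proof. by move=> i; exact: Yc_ge. Qed.
Let z_ge0 w : forall i, 0 <= z w i.
Proof. by move=> i; exact: polZ_ge0. Qed.

Definition Jcost (T : R) (n : nat) : R :=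
  \int[P]_w path_cost (yc w) (z w) (sc w) T n.

Lemma mean_Jcost (T : R) n : 0 <= T ->
  mean P (fun w => path_cost (yc w) (z w) (sc w) T n) (Jcost T n).
Proof.
move=> T0.
pose f i w := (Dw i w <= T)%R%:R *
    (((Num.min (Dw i.+1 w) T - Lw i w) ^+ 2 - Aw i w ^+ 2) / 2).
have mf i : mean P (f i) (\int[P]_w f i w).
  apply: (@mean_bounded _ _ _ _ _ (T ^+ 2)).
    apply: measurable_wrt_fun (@H_measurable i.+1) _.
    have HS := @measurable_wrtS _ _ R _ _ _ (@H_S i).
    apply: wrtM; first by apply: HS; exact: e_wrt.
    apply: wrtM; last exact: wrt_cst.
    apply: wrtB; apply: wrtX; last by apply: HS; exact: A_wrt.
    apply: wrtB; last by apply: HS; exact: L_wrt.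
    by apply: wrt_min; [exact: D_wrt|exact: wrt_cst].
  move=> w; rewrite /f; case: (boolP (Dw i w <= T)) => h; last first.
    by rewrite mul0r normr0 sqr_ge0.
  rewrite mul1r.
  have h1 := path_last_le (sc w) eps0 (y_eps w) (z_ge0 w) i.
  have h2 := path_last_ge0 (sc w) eps0 (y_eps w) (z_ge0 w) i.
  have h3 : Dw i w <= Num.min (Dw i.+1 w) T.
    by rewrite le_min h (path_delivS eps0 (y_eps w) (z_ge0 w) i).
  have h4 : Num.min (Dw i.+1 w) T <= T by rewrite ge_min lexx orbT.
  have h5 := path_age_ge0 (sc w) eps0 (y_eps w) (z_ge0 w) i.
  have h6 := path_age_le (sc w) eps0 (y_eps w) (z_ge0 w) i.
  have h7 : (Num.min (Dw i.+1 w) T - Lw i w) ^+ 2 <= T ^+ 2.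
    by apply: lerXn2r; rewrite ?nnegrE; lra.
  have h8 : Aw i w ^+ 2 <= T ^+ 2 by apply: lerXn2r; rewrite ?nnegrE; lra.
  have h9 := sqr_ge0 (Num.min (Dw i.+1 w) T - Lw i w).
  have h10 := sqr_ge0 (Aw i w).
  by rewrite ler_norml; apply/andP; split; lra.
apply: integrable_mean.
by have [] := @mean_sum _ _ _ P n f _ (fun i _ => mf i).
Qed.

(** The condition on [n] puts delivery [n] after [T] on every clamped path. The raw paths agree with
    the clamped ones off a null set, on which nothing is known about the inner integral; hence the
    use of [eq_integral_ae]. *)
Lemma avg_age_Jcost (T : R) n : 0 <= T -> T < n%:R * eps ->
  avg_age P Y succ pi T = (T^-1 * Jcost T n)%:E.
Proof.
move=> T0 Tn; rewrite /avg_age EFinM; congr (_ * _)%E.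
rewrite -(mean_integral (mean_Jcost n T0)).
apply: eq_integral_ae; apply: filterS Yc_ae => w hw.
have yE i : eps <= Y i.+1 w by rewrite -hw; exact: Yc_ge.
have hw' i : Y i.+1 w = Yc i.+1 w by rewrite hw.
rewrite (integral_age succ eps0 yE (fun i => polZ_ge0 i w) (n := n))//.
  by rewrite (@path_cost_ext R (fun i => Y i w) (yc w)).
by apply: lt_le_trans Tn _; exact: path_deliv_ge yE (z_ge0 w) n.
Qed.

Lemma mean_pover T n (Q : R) : 0 <= Q -> exists2 v,
  mean P (fun w => path_over (yc w) (z w) T n) v & 0 <= v <= Q ^+ 2 + n%:R * tailm Q.
Proof.
move=> Q0.
pose f i w := (Dw i w <= T)%R%:R * (~~ (Dw i.+1 w <= T)%R)%:R * Yc i.+1 w ^+ 2.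
have mf i : mean P (f i) (\int[P]_w f i w).
  have mY2 : mean P (fun w => Yc i.+1 w ^+ 2) EYsq.
    by apply: (@Yc_mean (fun x => x ^+ 2)); [exact: exprn_measurable|exact: mean_Ysq].
  apply: (mean_dominated mY2).
    apply: measurable_wrt_fun (@H_measurable i.+1) _.
    have HS := @measurable_wrtS _ _ R _ _ _ (@H_S i).
    apply: wrtM; last by apply: wrtX; exact: Yc_wrt.
    apply: wrtM; first by apply: HS; exact: e_wrt.
    rewrite (_ : (fun w => _) = fun w => 1 - (Dw i.+1 w <= T)%R%:R :> R); last first.
      by apply/funext => w; case: (_ <= T); rewrite /= ?subrr ?subr0.
    by apply: wrtB; [exact: wrt_cst|exact: e_wrt].
  move=> w; rewrite /f; have := sqr_ge0 (Yc i.+1 w).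
  case: (Dw i w <= T); case: (Dw i.+1 w <= T); rewrite /= ?mul0r ?mulr0 ?mul0r ?mul1r ?normr0//.
  by move=> ?; rewrite ger0_norm.
have mo : mean P (fun w => path_over (yc w) (z w) T n) (\sum_(i < n) \int[P]_w f i w).
  exact: (@mean_sum _ _ _ P n f _ (fun i _ => mf i)).
exists (\sum_(i < n) \int[P]_w f i w) => //; apply/andP; split.
  by apply: (mean_le (mean_cst P 0) mo) => w; exact: path_over_ge0.
have mt := meanD (mean_cst P (Q ^+ 2))
  (@mean_sum _ _ _ P n (fun i w => tail Q (Yc i.+1 w)) (fun=> tailm Q)
    (fun i _ => mean_tail Q i)).
rewrite sumr_const card_ord -mulr_natl in mt.
apply: (mean_le mo mt) => w.
exact: (@path_over_le R (yc w) (z w) eps eps0 (y_eps w) (z_ge0 w)).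
Qed.

Lemma Jcost_lower (T : R) n (delta Q : R) : 0 <= T -> T < n%:R * eps -> 0 < delta -> 0 <= Q ->
  beta * T <= (1 + delta) * Jcost T n
    + lower_cst c theta K delta * (1 + (Q ^+ 2 + n%:R * tailm Q)) - K.
Proof.
move=> T0 Tn d0 Q0; have c0 := c_ge0.
have [v mv /andP[v0 vQ]] := @mean_pover T n Q Q0.
(* The age at sampling with the wait cut at the horizon: still a function of the history, and at
   most [T] whenever [Dw i w <= T]. *)
pose b i w := Aw i w + Num.min (pol_Z pi i w) (T - Dw i w).
have hb i : measurable_wrt (H i) (b i).
  apply: wrtD; first exact: A_wrt.
  by apply: wrt_min; [exact: Z_wrt|apply: wrtB; [exact: wrt_cst|exact: D_wrt]].
have bM i w : Dw i w <= T -> 0 <= b i w <= T.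
  move=> h; have h5 := path_age_ge0 (sc w) eps0 (y_eps w) (z_ge0 w) i.
  have h6 := path_age_le (sc w) eps0 (y_eps w) (z_ge0 w) i.
  have : 0 <= Num.min (pol_Z pi i w) (T - Dw i w).
    by rewrite le_min polZ_ge0/= subr_ge0.
  have : Num.min (pol_Z pi i w) (T - Dw i w) <= T - Dw i w by rewrite ge_min lexx orbT.
  by rewrite /b; lra.
have ms := @mean_sum _ _ _ P n _ _ (fun i _ => drift_lb_mean (hb i) (bM i)).
have mr := meanB (meanD (meanB (meanZ (1 + delta) (mean_Jcost n T0)) (mean_cst P (beta * T)))
  (meanZ (lower_cst c theta K delta) (meanD (mean_cst P 1) mv))) (mean_cst P K).
have s0 : 0 <= \sum_(i < n) ((1 - alpha) / 2 * \int[P]_w ((Dw i w <= T)%R%:R *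
       ((b i w - theta) ^+ 2 - Num.max (b i w - theta) 0 ^+ 2))).
  apply: sumr_ge0 => i _; apply: mulr_ge0; first by rewrite divr_ge0// ltW// rho_gt0.
  apply: Rintegral_ge0 => w _; apply: mulr_ge0; first exact: ler0n.
  have := sqr_ge0 (b i w - theta); case: (leP (b i w - theta) 0) => h; rewrite ?expr0n/= ?subr0//.
  by rewrite subrr.
have le1 := le_trans s0 (mean_le ms mr _).
have {le1} : 0 <= (1 + delta) * Jcost T n - beta * T + lower_cst c theta K delta * (1 + v) - K.
  apply: le1 => w.
  have Tw : T < Dw n w.
    by apply: lt_le_trans Tn _; exact: (path_deliv_ge (y_eps w) (z_ge0 w)).
  have := path_drift_lower (sc w) eps0 (y_eps w) (z_ge0 w) K c0 theta0 T0 d0 Tw.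
  apply: le_trans; rewrite /path_drift; apply: ler_sum => i _.
  case: (boolP (Dw i w <= T)) => h; last by rewrite !mul0r.
  rewrite !mul1r; apply: drift_ge => //; first exact: le_trans (ltW eps0) (y_eps w i).
  by rewrite lerDl le_min polZ_ge0/= subr_ge0.
have L0 := lower_cst_ge0 c theta K d0.
have : lower_cst c theta K delta * (1 + v) <=
       lower_cst c theta K delta * (1 + (Q ^+ 2 + n%:R * tailm Q)).
  by apply: ler_wpM2l => //; lra.
lra.
Qed.

Lemma Jcost_upper (T : R) n (Q : R) :
  {ae P, forall w, forall i, pol_Z pi i w = Num.max (theta - Aw i w) 0} ->
  0 <= T -> T < n%:R * eps -> 0 <= Q ->
  Jcost T n <= beta * T + beta * (theta + 1 + (Q ^+ 2 + n%:R * tailm Q)).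
Proof.
move=> thr T0 Tn Q0; have c0 := c_ge0; have th0 := theta0.
have [v mv /andP[v0 vQ]] := @mean_pover T n Q Q0.
pose b i w := Num.max (Aw i w) theta.
have hb i : measurable_wrt (H i) (b i).
  by apply: wrt_max; [exact: A_wrt|exact: wrt_cst].
have bM i w : Dw i w <= T -> 0 <= b i w <= T + theta.
  move=> h; have h5 := path_age_ge0 (sc w) eps0 (y_eps w) (z_ge0 w) i.
  have h6 := path_age_le (sc w) eps0 (y_eps w) (z_ge0 w) i.
  by rewrite /b; case: (leP (Aw i w) theta) => ?; lra.
have ms := @mean_sum _ _ _ P n _ _ (fun i _ => drift_lb_mean (hb i) (bM i)).
(* As [b >= theta], the positive part is [b - theta] itself and every mean drift is zero. *)
rewrite [X in mean _ _ X](_ : _ = 0) in ms; last first.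
  apply: big1 => i _; rewrite [X in _ * X](_ : _ = 0) ?mulr0//.
  rewrite [LHS](_ : _ = \int[P]_w (0 : R)); last first.
    apply: eq_Rintegral => w _; rewrite maxr_idl ?subrr ?mulr0//.
    by rewrite subr_ge0 /b le_max lexx orbT.
  by case: (mean_cst P 0).
have mr := meanD (meanD ms (mean_cst P (beta * T)))
   (meanZ beta (meanD (mean_cst P (theta + 1)) mv)).
have le1 : Jcost T n <= 0 + beta * T + beta * (theta + 1 + v).
  apply: (mean_le_ae (mean_Jcost n T0) mr); apply: filterS thr => w hw.
  have Tw : T < Dw n w.
    by apply: lt_le_trans Tn _; exact: (path_deliv_ge (y_eps w) (z_ge0 w)).
  have := @path_cost_upper R (yc w) (z w) (sc w) eps eps0 (y_eps w) (z_ge0 w)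
    c theta K T c0 theta0 T0 n hw Tw.
  rewrite /path_drift; move=> /le_trans; apply; rewrite lerD2r lerD2r.
  apply: ler_sum => i _; rewrite drift_max//.
  exact: le_trans (ltW eps0) (y_eps w i).
have : beta * (theta + 1 + v) <= beta * (theta + 1 + (Q ^+ 2 + n%:R * tailm Q)).
  by apply: ler_wpM2l; lra.
lra.
Qed.

Lemma tailm_ge0 Q : 0 <= tailm Q.
Proof. by apply: Rintegral_ge0 => w _; exact: tail_ge0. Qed.

Lemma tailm_small (eta : R) : 0 < eta -> exists2 Q, 0 <= Q & tailm Q <= eta.
Proof.
move=> eta0.
have mt n : measurable_fun setT (fun w => (tail n%:R (Yc 1%N w))%:E).
  apply/measurable_EFinP; apply: measurableT_comp; last exact: measurable_Yc.
  exact: measurable_tail.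
have cv : (\int[P]_w (tail n%:R (Yc 1%N w))%:E @[n --> \oo] --> \int[P]_w (cst 0 w))%E.
  have [] := @dominated_convergence _ _ _ P setT measurableT
    (fun n w => (tail n%:R (Yc 1%N w))%:E) (cst 0%E) (fun w => (Yc 1%N w ^+ 2)%:E) => //.
  - apply: aeW => w _; apply: cvg_near_cst.
    near=> n; apply/eqP; rewrite /tail ltNge (_ : Yc 1%N w <= n%:R)//.
    near: n; exact: nbhs_infty_ger.
  - by case: mean_Ysq.
  - apply: aeW => w n _ /=; rewrite lee_fin ger0_norm ?tail_ge0// /tail.
    by case: ifP => // _; exact: sqr_ge0.
rewrite integral0 in cv.
have [N _ hN] := cvgr_lt _ (fine_cvg cv) _ eta0.
exists N%:R => //; exact: ltW (hN N (leqnn N)).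
Unshelve. all: by end_near. Qed.

(** The linear bound on [n] turns [n * tailm Q] into a small multiple of [T] once [Q] is large. *)
Lemma slots_exist (T : R) : 0 <= T ->
  exists n : nat, T < n%:R * eps /\ n%:R <= T / eps + 1.
Proof.
move=> T0; have Te : 0 <= T / eps by rewrite divr_ge0// ltW.
exists (Num.truncn (T / eps)).+1; have /andP[h1 h2] := truncn_itv Te.
by rewrite -ltr_pdivrMr// h2 -natr1 lerD2r.
Qed.

Lemma avg_age_lower (eta : R) : 0 < eta -> exists T0 : R, 0 < T0 /\
  forall T, T0 < T -> ((beta - eta)%:E <= avg_age P Y succ pi T)%E.
Proof.
move=> eta0; have c0 := c_ge0; have th0 := theta0; have e0 := eps0.
(* The allowance [eta * T] is split in three: [eta / 2] for the factor [1 + delta], [eta / 4] for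
   the tail, [eta / 4] for the constants collected in [B]. The choices come in the order [delta],
   then [C], then [Q], then [T]; the [+ 1] in the denominators covers [beta] or [C] equal to
   zero. *)
pose delta := eta / (2 * (beta + 1)).
have delta0 : 0 < delta by rewrite divr_gt0//; lra.
have dbeta : delta * beta <= eta / 2.
  rewrite /delta mulrAC ler_pdivrMr; last lra.
  have := mulr_ge0 (ltW eta0) (_ : 0 <= beta); rewrite mulrDr; lra.
pose C := lower_cst c theta K delta.
have C0 : 0 <= C by exact: lower_cst_ge0.
have [Q Q0 tQ] : exists2 Q, 0 <= Q & tailm Q <= eta * eps / (4 * (C + 1)).
  by apply: tailm_small; rewrite divr_gt0 ?mulr_gt0//; lra.
have Ct : C * tailm Q <= eta * eps / 4.
  have := tailm_ge0 Q; move: tQ; rewrite ler_pdivlMr; last lra.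
  by rewrite mulrDr mulr1 => ? ?; lra.
pose B := C * (1 + Q ^+ 2 + tailm Q) + `|K|.
have B0 : 0 <= B.
  by rewrite addr_ge0 ?mulr_ge0 ?normr_ge0// !addr_ge0 ?sqr_ge0 ?tailm_ge0.
have q0 : 0 <= 4 * B / eta by apply: divr_ge0; [apply: mulr_ge0|exact: ltW].
exists (4 * B / eta + 1); split; first by lra.
move=> T TT.
have T0 : 0 < T by lra.
have [n [Tn nT]] := slots_exist (ltW T0).
rewrite (avg_age_Jcost (ltW T0) Tn) lee_fin mulrC ler_pdivlMr//.
rewrite leNgt; apply/negP => J1.
have := Jcost_lower (ltW T0) Tn delta0 Q0; rewrite -/C.
have h1 : (1 + delta) * Jcost T n <= (1 + delta) * ((beta - eta) * T).
  by apply: ler_wpM2l; [lra|exact: ltW].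
have h2 : delta * beta * T <= eta / 2 * T by rewrite ler_pM2r.
have h3 : 0 <= delta * eta * T by apply: mulr_ge0; [apply: mulr_ge0|]; exact: ltW.
have h4 : C * (n%:R * tailm Q) <= eta / 4 * T + C * tailm Q.
  have : n%:R * (C * tailm Q) <= (T / eps + 1) * (C * tailm Q).
    by apply: ler_wpM2r => //; rewrite mulr_ge0// tailm_ge0.
  have : T / eps * (C * tailm Q) <= T / eps * (eta * eps / 4).
    by apply: ler_wpM2l => //; rewrite divr_ge0// ltW.
  rewrite [X in _ <= X -> _](_ : _ = eta / 4 * T); last by field; rewrite gt_eqF.
  by move=> ? ?; lra.
have h5 : 4 * B < eta * T.
  by rewrite [ltRHS]mulrC -ltr_pdivrMr//; apply: lt_trans TT; lra.
have := ler_norm (- K); rewrite normrN => h6.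
have h7 : B = C + C * Q ^+ 2 + C * tailm Q + `|K| by rewrite /B; ring.
have h8 : C * (1 + (Q ^+ 2 + n%:R * tailm Q)) = C + C * Q ^+ 2 + C * (n%:R * tailm Q) by ring.
have h9 : (1 + delta) * ((beta - eta) * T) =
  beta * T - eta * T + delta * beta * T - delta * eta * T by ring.
rewrite h8; lra.
Qed.

Lemma avg_age_upper (eta : R) :
  {ae P, forall w, forall i, pol_Z pi i w = Num.max (theta - Aw i w) 0} ->
  0 < eta -> exists T0 : R, 0 < T0 /\
  forall T, T0 < T -> (avg_age P Y succ pi T <= (beta + eta)%:E)%E.
Proof.
move=> thr eta0; have c0 := c_ge0; have th0 := theta0; have e0 := eps0.
have [Q Q0 tQ] : exists2 Q, 0 <= Q & tailm Q <= eta * eps / (4 * (beta + 1)).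
  by apply: tailm_small; rewrite divr_gt0 ?mulr_gt0//; lra.
have b0 : 0 <= beta by lra.
have Ct : beta * tailm Q <= eta * eps / 4.
  have := tailm_ge0 Q; move: tQ; rewrite ler_pdivlMr; last lra.
  by move=> ? ?; lra.
pose B := beta * (theta + 1 + Q ^+ 2 + tailm Q).
have B0 : 0 <= B.
  by rewrite mulr_ge0// !addr_ge0 ?sqr_ge0 ?tailm_ge0.
have q0 : 0 <= 4 * B / eta by apply: divr_ge0; [apply: mulr_ge0|exact: ltW].
exists (4 * B / eta + 1); split; first by lra.
move=> T TT.
have T0 : 0 < T by lra.
have [n [Tn nT]] := slots_exist (ltW T0).
rewrite (avg_age_Jcost (ltW T0) Tn) lee_fin mulrC ler_pdivrMr//.
have := Jcost_upper thr (ltW T0) Tn Q0.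
have h4 : beta * (n%:R * tailm Q) <= eta / 4 * T + beta * tailm Q.
  have : n%:R * (beta * tailm Q) <= (T / eps + 1) * (beta * tailm Q).
    by apply: ler_wpM2r => //; rewrite mulr_ge0// tailm_ge0.
  have : T / eps * (beta * tailm Q) <= T / eps * (eta * eps / 4).
    by apply: ler_wpM2l => //; rewrite divr_ge0// ltW.
  rewrite [X in _ <= X -> _](_ : _ = eta / 4 * T); last by field; rewrite gt_eqF.
  by move=> ? ?; lra.
have h5 : 4 * B < eta * T.
  by rewrite [ltRHS]mulrC -ltr_pdivrMr//; apply: lt_trans TT; lra.
have h7 : B = beta * (theta + 1 + Q ^+ 2) + beta * tailm Q by rewrite /B; ring.
have h8 : beta * (theta + 1 + (Q ^+ 2 + n%:R * tailm Q)) =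
  beta * (theta + 1 + Q ^+ 2) + beta * (n%:R * tailm Q) by ring.
rewrite h8 (mulrDl beta eta T); lra.
Qed.

Lemma avg_cost_ge : (beta%:E <= avg_cost P Y succ pi)%E.
Proof.
apply/lee_addgt0Pr => eta eta0; rewrite -leeBlDr// -EFinB.
have [T0 [_ hT]] := avg_age_lower eta0.
rewrite /avg_cost limf_esupE; apply: le_ereal_inf_tmp => _ [A [M [_ hM]] <-].
pose T := Num.max M T0 + 1.
have MT : M < T by rewrite /T ltr_pwDr// le_max lexx.
have T0T : T0 < T by rewrite /T ltr_pwDr// le_max lexx orbT.
by apply: le_trans (hT _ T0T) _; apply: ereal_sup_ubound; exists T => //; exact: hM.
Qed.

Lemma avg_cost_le :
  {ae P, forall w, forall i, pol_Z pi i w = Num.max (theta - Aw i w) 0} ->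
  (avg_cost P Y succ pi <= beta%:E)%E.
Proof.
move=> thr; apply/lee_addgt0Pr => eta eta0; rewrite -EFinD.
have [T0 [_ hT]] := avg_age_upper thr eta0.
rewrite /avg_cost limf_esupE.
apply: (@le_trans _ _ (ereal_sup (avg_age P Y succ pi @` [set T | T0 < T]))).
  apply: ereal_inf_lbound; exists [set T | T0 < T] => //.
  by exists T0; split; first exact: num_real.
by apply: ge_ereal_sup => _ [T /= TT <-]; exact: hT.
Qed.

End system.

(** * The threshold policy *)

Section threshold_path.
Context {d : measure_display} {Omega : measurableType d} {R : realType}.
Variables (Y : nat -> Omega -> R) (succ : nat -> Omega -> bool).
Variables (pi : policy (Omega := Omega) (R := R)) (w : Omega) (eps theta : R).
Hypotheses (eps0 : 0 < eps) (yeps : forall i, eps <= Y i.+1 w)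
  (z0 : forall i, 0 <= pol_Z pi i w).
Local Notation y := (fun i => Y i w).
Local Notation z := (fun i => pol_Z pi i w).
Local Notation s := (fun i => succ i w).
Local Notation D := (path_deliv y z).
Local Notation L := (path_last y z s).
Local Notation waits i := [set t | deliv Y pi i w <= t /\ theta <= age Y succ pi t w].

(** Only before [D i.+1] is the age equal to [t - L i]; the hypothesis places the first crossing
    inside this slot, where it can be computed. *)
Lemma waits_inf i : (exists2 t, waits i t & t < D i.+1) ->
  inf (waits i) = Num.max (D i) (L i + theta).
Proof.
move=> [t [Dt at_] tD]; rewrite delivE in Dt.
have ageE u : D i <= u -> u < D i.+1 -> age Y succ pi u w = u - L i.
  exact: (age_eq succ eps0 yeps z0).
set tau := Num.max _ _.
have tau_t : tau <= t.
  by move: at_; rewrite ageE// /tau ge_max Dt/= => ?; lra.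
have Wtau : waits i tau.
  split; first by rewrite delivE le_max lexx.
  rewrite ageE ?le_max ?lexx//; last exact: le_lt_trans tau_t tD.
  by rewrite lerBrDr addrC le_max lexx orbT.
have lbtau : lbound (waits i) tau.
  move=> u [Du au]; rewrite delivE in Du; have [uD|uD] := ltP u (D i.+1).
    by move: au; rewrite ageE// /tau ge_max Du/= => ?; lra.
  exact: le_trans tau_t (le_trans (ltW tD) uD).
apply/eqP; rewrite eq_le; apply/andP; split.
- by apply: ge_inf => //; exists tau.
- by apply: lb_le_inf => //; exists tau.
Qed.

Let waitE i : D i + Num.max (theta - path_age y z s i) 0 = Num.max (D i) (L i + theta).
Proof.
rewrite /path_age; have [h|h] := leP (D i) (L i + theta).
  by rewrite maxr_idl; [ring|lra].
by rewrite maxr_idr; [ring|lra].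
Qed.

(** The assumed equation is implicit, since [age] depends on the very wait to be found. It says that
    the infimum is [D i.+1 - y i.+1], so some crossing time lies before [D i.+1] and [waits_inf]
    applies. *)
Lemma threshold_wait :
  (forall i, samp Y pi i.+1 w = inf (waits i)) ->
  forall i, pol_Z pi i w = Num.max (theta - path_age y z s i) 0.
Proof.
move=> h i; have e0 := eps0; have yi := yeps i; have zi := z0 i.
have DS j : D j.+1 = samp Y pi j.+1 w + y j.+1 by rewrite sampE.
(* The infimum of an empty set is [0] by convention. If [waits i] were empty, so would be
   [waits i.+1], and sample [i.+2] would be taken at time [0], although [D i.+1 > 0]. Passing to
   [i.+1] matters: for [i = 0] a sample at time [0] is no contradiction. *)
have ne : has_inf (waits i).
  split; last by exists (D i) => t [+ _]; rewrite delivE.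
  apply: contrapT => E.
  have := h i.+1; rewrite inf_out.
    rewrite sampE => D0; have := @path_deliv_ge R y z eps yeps z0 i.+1.
    have : 0 < i.+1%:R * eps by rewrite mulr_gt0.
    by have := z0 i.+1; lra.
  move=> [[t [Dt at_]] _]; apply: E; exists t; split => //.
  by apply: le_trans Dt; rewrite !delivE; exact: (@path_delivS R y z eps eps0 yeps z0).
have [t Wt tlt] := @inf_adherent R (waits i) (y i.+1) (lt_le_trans eps0 yi) ne.
have := h i; rewrite waits_inf; last by exists t => //; rewrite DS h.
rewrite sampE -waitE => E; lra.
Qed.

Lemma wait_threshold :
  (forall i, pol_Z pi i w = Num.max (theta - path_age y z s i) 0) ->
  forall i, samp Y pi i.+1 w = inf (waits i).
Proof.
move=> h i; have e0 := eps0; have yi := yeps i.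
have E : D i + pol_Z pi i w = Num.max (D i) (L i + theta) by rewrite h waitE.
have lt : Num.max (D i) (L i + theta) < D i.+1 by rewrite -E/=; lra.
rewrite waits_inf ?sampE//; exists (Num.max (D i) (L i + theta)) => //; split.
  by rewrite delivE le_max lexx.
rewrite (age_eq succ eps0 yeps z0 (i := i))// ?le_max ?lexx//.
by rewrite lerBrDr addrC le_max lexx orbT.
Qed.

End threshold_path.

Section threshold_policy_exists.
Context {d : measure_display} {Omega : measurableType d} {R : realType}.
Variables (P : probability Omega R) (eps theta : R).
Variables (Y : nat -> Omega -> R) (succ : nat -> Omega -> bool).
Hypotheses (eps0 : 0 < eps) (theta0 : 0 <= theta).

(** A policy must prescribe its waits before the trajectory they generate exists, so the age at
    deliveries gets its own recursion; [thr_ageE] identifies it afterwards. *)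
Fixpoint thr_age (i : nat) (w : Omega) : R :=
  if i is j.+1 then
    (if succ j.+1 w then Yc eps Y j.+1 w
     else Num.max (thr_age j w) theta + Yc eps Y j.+1 w)
  else 0.

Definition thr_pol : policy (Omega := Omega) (R := R) :=
  Policy (fun=> 0) (fun i w => Num.max (theta - thr_age i w) 0).

Lemma thr_ageE i w :
  path_age (fun i => Yc eps Y i w) (fun i => pol_Z thr_pol i w) (fun i => succ i w) i = thr_age i w.
Proof.
elim: i => [|i IH]; first by rewrite /path_age/= subrr.
rewrite path_ageS IH/=; case: ifP => // _; congr (_ + _).
have [h|h] := leP (thr_age i w) theta.
  by rewrite maxr_idl; [ring|lra].
by rewrite maxr_idr; [ring|lra].
Qed.

Lemma thr_age_ge0 i w : 0 <= thr_age i w.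
Proof.
have yc0 j : 0 <= Yc eps Y j w by exact: le_trans (ltW eps0) (Yc_ge _ _ _ _).
case: i => [|i]//=; case: ifP => // _; apply: addr_ge0 => //.
by rewrite le_max theta0 orbT.
Qed.

Lemma indep_sigma_cst (k : R) (F : set (set Omega)) :
  indep_sigma P (sigma_gen [set (fun=> k : R)]) F.
Proof.
have triv : sigma_gen [set (fun _ : Omega => k : R)] `<=` [set A | A = set0 \/ A = setT].
  apply: smallest_sub.
    split; first by left.
    - by move=> A [->|->]; [right; rewrite setD0|left; rewrite setDv].
    - move=> A hA; have [[n An]|nA] := pselect (exists n, A n = setT).
        by right; apply/seteqP; split => // x _; exists n => //; rewrite An.
      left; apply/seteqP; split => // x [n _]; case: (hA n) => [->//|h].
      by exfalso; apply: nA; exists n.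
  move=> _ [_ -> [B mB ->]]; have [kB|kB] := pselect (B k).
    by right; apply/seteqP; split.
  by left; apply/seteqP; split.
move=> A B /triv[->|->] _; first by rewrite set0I measure0 mul0e.
by rewrite setTI probability_setT mul1e.
Qed.

Lemma thr_pol_in_Pi : in_Pi P Y succ thr_pol.
Proof.
split.
- exact: measurable_cst.
- exact: indep_sigma_cst.
- by move=> i w /=; rewrite le_max lexx orbT.
- move=> i.
  suff h : measurable_wrt (sigma_gen (hist_gen Y succ (pol_U thr_pol) i)) (thr_age i).
    by apply: wrt_max; [apply: wrtB => //|]; exact: wrt_cst.
  have HS j : sigma_gen (hist_gen Y succ (pol_U thr_pol) j) `<=`
              sigma_gen (hist_gen Y succ (pol_U thr_pol) j.+1).
    apply: sigma_genS => X [->|[k /andP[k1 kj] hk]]; first by left.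
    by right; exists k => //; rewrite k1 leqW.
  elim: i => [|i IH]; first exact: wrt_cst.
  have hy : measurable_wrt (sigma_gen (hist_gen Y succ (pol_U thr_pol) i.+1)) (Yc eps Y i.+1).
    apply: wrt_max; last exact: wrt_cst.
    by apply: sigma_gen_in; right; exists i.+1 => //; [rewrite leqnn|left].
  have hs : measurable_wrt (sigma_gen (hist_gen Y succ (pol_U thr_pol) i.+1)) (@succR _ _ R succ i.+1).
    by apply: sigma_gen_in; right; exists i.+1 => //; [rewrite leqnn|right].
  rewrite (_ : thr_age i.+1 = fun w =>
    (1 - succR succ i.+1 w) * Num.max (thr_age i w) theta + Yc eps Y i.+1 w).
    apply: wrtD => //; apply: wrtM; first by apply: wrtB => //; exact: wrt_cst.
    by apply: wrt_max; [exact: measurable_wrtS (HS i) _|exact: wrt_cst].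
  by apply/funext => w /=; rewrite /succR; case: (succ i.+1 w) => /=; ring.
- move=> n; exists (fun=> theta); split => //.
  + apply: aeW => w /=; rewrite ge_max theta0 andbT gerBl; exact: thr_age_ge0.
  + by rewrite expectation_cst ltry.
  + exact: indep_sigma_cst.
Qed.

End threshold_policy_exists.

(** * Existence of the root *)

Section threshold_root.
Context {d : measure_display} {Omega : measurableType d} {R : realType}.
Variables (P : probability Omega R) (alpha : R) (Y : Omega -> R) (m s : R).
Hypotheses (alpha01 : 0 <= alpha < 1) (Y0 : forall w, 0 <= Y w).
Hypotheses (mY : mean P Y m) (mY2 : mean P (fun w => Y w ^+ 2) s).
Hypothesis ms : m ^+ 2 <= s.
Local Notation c := (m / (1 - alpha)).
Local Notation s' := ((s + 2 * alpha * c * m) / (1 - alpha)).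
Local Notation K theta := ((s' - c ^+ 2 - (theta + c) ^+ 2) / 2).

(** The inner [max x 0] keeps the integrand below [Y ^ 2] and makes [q] Lipschitz on the whole line,
    while nothing changes for [x >= 0]. *)
Let q (x : R) : R := \int[P]_w (Num.max (Y w - Num.max x 0) 0 ^+ 2).

Let cut_le (x : R) w : 0 <= x -> 0 <= Num.max (Y w - x) 0 <= Y w.
Proof.
by move=> x0; have := Y0 w; case: (leP (Y w - x) 0) => h ?; apply/andP; split; lra.
Qed.

Let mean_q x : mean P (fun w => Num.max (Y w - Num.max x 0) 0 ^+ 2) (q x).
Proof.
apply: (mean_dominated mY2).
  apply: measurable_funX; apply: measurable_maxr => //; apply: measurable_funB => //.
  exact: mean_measurable mY.
move=> w; have /andP[h1 h2] : 0 <= Num.max (Y w - Num.max x 0) 0 <= Y w.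
  by apply: cut_le; rewrite le_max lexx orbT.
by rewrite ger0_norm ?sqr_ge0//; apply: lerXn2r; rewrite ?nnegrE.
Qed.

Let m_ge0 : 0 <= m.
Proof. exact: (mean_le (mean_cst P 0) mY). Qed.

Let q_lip (x x' : R) : `|q x - q x'| <= 2 * m * `|x - x'|.
Proof.
suff H (a b : R) : q a - q b <= 2 * m * `|a - b|.
  by rewrite ler_norml H andbT lerNl opprB distrC H.
have mm := meanZ `|a - b| (meanZ 2 mY).
rewrite mulrC; apply: (mean_le (meanB (mean_q a) (mean_q b)) mm) => w.
have aa0 : 0 <= Num.max a 0 by rewrite le_max lexx orbT.
have bb0 : 0 <= Num.max b 0 by rewrite le_max lexx orbT.
have /andP[h1 h2] := cut_le w aa0; have /andP[h3 h4] := cut_le w bb0.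
set u := Num.max (Y w - _) 0 in h1 h2 *; set v := Num.max (Y w - _) 0 in h3 h4 *.
have uv : u - v <= `|a - b|.
  have n0 := normr_ge0 (a - b); have n1 := ler_norm (b - a); rewrite distrC in n1.
  have ba : Num.max b 0 - Num.max a 0 <= `|a - b|.
    by case: (leP a 0) => ?; case: (leP b 0) => ?; lra.
  rewrite /u /v; move: ba; move: (Num.max a 0) (Num.max b 0) => a' b' ba.
  by case: (leP (Y w - a') 0) => ?; case: (leP (Y w - b') 0) => ?; lra.
have -> : u ^+ 2 - v ^+ 2 = (u - v) * (u + v) by ring.
apply: (@le_trans _ _ (`|a - b| * (u + v))).
  by apply: ler_wpM2r => //; lra.
by apply: ler_wpM2l => //; lra.
Qed.

(** For [theta >= 0], [G theta] below is the mean of [relval] at [Y]. At [0] it equals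
    [s' / 2 - alpha * c ^ 2], nonnegative because [m ^ 2 <= s] gives [(1 + alpha) * c ^ 2 <= s'];
    for large [theta] the term [- (theta + c) ^ 2 / 2] prevails. *)
Lemma threshold_root_exists : exists2 theta, 0 <= theta &
  mean P (fun w => relval c theta (K theta) (Y w)) 0.
Proof.
have rho0 : 0 < 1 - alpha by case/andP: alpha01; lra.
have m0 := m_ge0.
have cm : m = c * (1 - alpha) by rewrite divfK// gt_eqF.
have c0 : 0 <= c by rewrite divr_ge0// ltW.
pose G (theta : R) : R := K theta + q theta / 2 - s / 2 + (theta + c) * m.
have s'ge : (1 + alpha) * c ^+ 2 <= s'.
  rewrite ler_pdivlMr//.
  have := ms; rewrite [X in X ^+ 2]cm => ?.
  rewrite [X in _ <= _ + _ * X]cm.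
  have -> : (1 + alpha) * c ^+ 2 * (1 - alpha) =
    (c * (1 - alpha)) ^+ 2 + 2 * alpha * c * (c * (1 - alpha)) by ring.
  by rewrite lerD2r.
have s'0 : 0 <= s'.
  by apply: le_trans s'ge; rewrite mulr_ge0 ?sqr_ge0// addr_ge0//; case/andP: alpha01.
have G0 : 0 <= G 0.
  have q0 : q 0 = s.
    have := mean_unique (mean_q 0); apply.
    apply: mean_ext mY2 => w; rewrite maxxx subr0 maxr_idl//.
  have h : 0 <= (1 - alpha) * c ^+ 2 by rewrite mulr_ge0 ?sqr_ge0// ltW.
  have E : c * m = (1 - alpha) * c ^+ 2 by rewrite {2}cm; ring.
  by rewrite /G q0 add0r E; lra.
(* Chosen so that [M + c >= 1] and [M + c - 2 * m = 1 + s' + c]; the product of these two then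
   exceeds [s']. *)
pose M := 2 * m + 1 + s'.
have M0 : 0 <= M by rewrite /M; lra.
have GM : G M <= 0.
  have qs : q M <= s.
    apply: (mean_le (mean_q M) mY2) => w.
    have /andP[h1 h2] : 0 <= Num.max (Y w - Num.max M 0) 0 <= Y w.
      by apply: cut_le; rewrite le_max lexx orbT.
    by apply: lerXn2r; rewrite ?nnegrE.
  have N1 : 0 <= (M + c - 1) * (M + c - 2 * m) by apply: mulr_ge0; rewrite /M; lra.
  have N2 : M + c - 2 * m = 1 + s' + c by rewrite /M; ring.
  have c2 := sqr_ge0 c.
  rewrite /G.
  have -> : (s' - c ^+ 2 - (M + c) ^+ 2) / 2 + q M / 2 - s / 2 + (M + c) * m =
    (s' - c ^+ 2 - ((M + c - 1) * (M + c - 2 * m) + (M + c - 2 * m))) / 2 + (q M - s) / 2.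
    by field; rewrite gt_eqF.
  by rewrite N2 in N1 *; lra.
have cq : continuous q.
  move=> x; apply/cvgrPdist_lt => e e0.
  have k0 : 0 < 2 * m + 1 by lra.
  near=> t.
  apply: le_lt_trans (q_lip x t) _.
  apply: (@le_lt_trans _ _ ((2 * m + 1) * `|x - t|)).
    by apply: ler_wpM2r => //; lra.
  rewrite mulrC -ltr_pdivlMr//; near: t.
  by apply: cvgr_dist_lt; [exact: cvg_id|rewrite divr_gt0].
have cG : continuous G.
  move=> x; apply: cvgD; last first.
    by apply: cvgMl; apply: cvgD; [exact: cvg_id|exact: cvg_cst].
  apply: cvgB; last exact: cvg_cst.
  apply: cvgD; last by apply: cvgMl; exact: cq.
  apply: cvgMl; apply: cvgB; first exact: cvg_cst.
  apply: (@cvgM _ _ _ _ (fun t => t + c) (fun t => t + c));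
    apply: cvgD; try exact: cvg_id; exact: cvg_cst.
have G0M : Num.min (G 0) (G M) <= 0 <= Num.max (G 0) (G M).
  by rewrite ge_min GM orbT le_max G0.
have [theta] := IVT M0 (continuous_subspaceT cG) G0M.
rewrite in_itv/= => /andP[th0 _] Gth; exists theta => //.
rewrite -Gth /G; apply: (@mean_ext _ _ _ P (fun w =>
  K theta + 2^-1 * Num.max (Y w - Num.max theta 0) 0 ^+ 2 - 2^-1 * Y w ^+ 2 + (theta + c) * Y w)).
  by move=> w; rewrite /relval (maxr_idl th0); field; rewrite gt_eqF.
rewrite (mulrC (q theta)) (mulrC s).
apply: meanD; last exact: meanZ.
apply: meanB; last exact: meanZ.
apply: meanD; [exact: mean_cst|exact: meanZ].
Unshelve. all: by end_near. Qed.

End threshold_root.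

(** * The root equation *)

Section geometric_limits.
Context {R : realType}.
Variable alpha : R.
Hypothesis alpha01 : 0 <= alpha < 1.

Lemma cvg_geom : alpha ^+ n @[n --> \oo] --> 0.
Proof. by case/andP: alpha01 => a0 a1; apply: cvg_expr; rewrite ger0_norm. Qed.

(** These are the terms of a convergent series: the closed form [uE] bounds its partial sums by
    [alpha / (1 - alpha) ^ 2]. *)
Lemma cvg_natmul_geom : n%:R * alpha ^+ n @[n --> \oo] --> 0.
Proof.
have /andP[a0 a1] := alpha01.
have rho0 : 0 < 1 - alpha by lra.
pose u n : R := n%:R * alpha ^+ n.
have u0 n : 0 <= u n by rewrite mulr_ge0// exprn_ge0.
have uE n : series u n = (alpha - alpha * alpha ^+ n - (1 - alpha) * u n) / (1 - alpha) ^+ 2.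
  elim: n => [|n IH]; first by rewrite /series/= big_geq// /u expr0; field; rewrite gt_eqF.
  rewrite seriesSr IH /u (exprS alpha n) -natr1.
  by field; rewrite gt_eqF.
apply: (cvg_series_cvg_0 (u_ := u)); apply: nondecreasing_is_cvgn.
  by apply: nondecreasing_series => n _ _; exact: u0.
exists (alpha / (1 - alpha) ^+ 2) => _ [n _ <-].
rewrite uE ler_pM2r ?invr_gt0 ?exprn_gt0//.
have : 0 <= alpha * alpha ^+ n by rewrite mulr_ge0// exprn_ge0.
have : 0 <= (1 - alpha) * u n by rewrite mulr_ge0// ltW.
lra.
Qed.

End geometric_limits.

Section geometric_sum.
Context {d : measure_display} {Omega : measurableType d} {R : realType}.
Variables (P : probability Omega R) (alpha theta m s : R).
Variables (Yr : Omega -> R) (M : Omega -> nat) (Ys : nat -> Omega -> R).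
Hypotheses (alpha01 : 0 <= alpha < 1) (theta0 : 0 <= theta).
Hypothesis mYr : measurable_fun setT Yr.
Hypothesis mM : measurable_fun setT (fun w => (M w)%:R : R).
Hypothesis mYs : forall k, measurable_fun setT (Ys k).
Hypothesis PM : forall k, (1 <= k)%N ->
  P [set w | M w = k] = (alpha ^+ k.-1 * (1 - alpha))%:E.
Let fam : nat -> Omega -> R := fun k => match k with
  | 0%N => Yr | 1%N => fun w => (M w)%:R | k'.+2 => Ys k'.+1 end.
Hypothesis ind : mutually_independent P fam.
Hypothesis Yr2 : mean P (fun w => Yr w ^+ 2) s.
Hypotheses (Ys1 : forall k, mean P (Ys k.+1) m)
  (Ys2 : forall k, mean P (fun w => Ys k.+1 w ^+ 2) s).
Hypothesis Ys0 : {ae P, forall w, forall k, 0 <= Ys k.+1 w}.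

Let mfam k : measurable_fun setT (fam k).
Proof. by case: k => [|[|k]]; [exact: mYr|exact: mM|exact: mYs]. Qed.

Let I k w : R := (k%:R <= (M w)%:R :> R)%R%:R.
Let Z k w : R := Num.max (Ys k w) 0.
Let b w : R := Num.max theta (Yr w).
Let eb := \int[P]_w b w.
Let eb2 := \int[P]_w (b w ^+ 2).
(** The random number of summands is encoded by the indicators [k <= M], up to a fixed rank [n]. The
    variant [V] without indicators does not involve [M] and coincides with [X n] where
    [M >= n.+1]. *)
Let X n w := b w + \sum_(k < n) I k.+1 w * Z k.+1 w.
Let V n w := b w + \sum_(k < n) Z k.+1 w.
Local Notation blk J := (sigma_gen [set f | exists2 i, J i & f = fam i]).

Let mblk J : blk J `<=` measurable.
Proof. by apply: sigma_gen_measurable => f [i _ ->]; exact: mfam. Qed.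

Let Z0 k w : 0 <= Z k w.
Proof. by rewrite /Z le_max lexx orbT. Qed.

Let b0 w : 0 <= b w.
Proof. by rewrite /b le_max theta0. Qed.

Let mZ1 k : mean P (Z k.+1) m.
Proof.
apply: (mean_ae (Ys1 k)); first by apply: measurable_maxr.
by apply: filterS Ys0 => w h; rewrite /Z maxr_idl.
Qed.

Let mZ2 k : mean P (fun w => Z k.+1 w ^+ 2) s.
Proof.
apply: (mean_ae (Ys2 k)); first by apply: measurable_funX; apply: measurable_maxr.
by apply: filterS Ys0 => w h; rewrite /Z maxr_idl.
Qed.

Lemma mean_b : mean P b eb.
Proof.
have h := meanD (mean_cst P (theta + 1)) Yr2.
apply: (mean_dominated h); first by apply: measurable_maxr.
move=> w; rewrite ger0_norm// /b ge_max; apply/andP; split.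
  by rewrite -addrA lerDl addr_ge0// sqr_ge0.
have t0 := theta0; have := sqr_ge0 (Yr w - 1); have := sqr_ge0 (Yr w); rewrite !expr2; lra.
Qed.

Lemma mean_b2 : mean P (fun w => b w ^+ 2) eb2.
Proof.
have h := meanD (mean_cst P (theta ^+ 2)) Yr2.
apply: (mean_dominated h); first by apply: measurable_funX; apply: measurable_maxr.
move=> w; rewrite ger0_norm ?sqr_ge0// /b; have := sqr_ge0 theta; have := sqr_ge0 (Yr w).
by case: (leP theta (Yr w)) => *; lra.
Qed.

Let bV J : J 0%N -> measurable_wrt (blk J) b.
Proof.
by move=> J0; apply: wrt_max; [exact: wrt_cst|apply: sigma_gen_in; exists 0%N].
Qed.

Let bZ J k : J k.+2 -> measurable_wrt (blk J) (Z k.+1).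
Proof.
by move=> Jk; apply: wrt_max; [apply: sigma_gen_in; exists k.+2|exact: wrt_cst].
Qed.

Let bI J k : J 1%N -> measurable_wrt (blk J) (I k).
Proof.
by move=> J1; apply: wrt_le; [exact: wrt_cst|apply: sigma_gen_in; exists 1%N].
Qed.

(** The law of [M] is prescribed on positive integers only. The mass at [0] is carried along until
    [meanI], where [alpha ^ n - p >= 0] for all [n] forces it to vanish. *)
Let p := fine (P [set w | M w = 0%N]).

Let mean_M k : mean P (I k.+1) (alpha ^+ k - p).
Proof.
have mA j : measurable [set w | M w = j].
  rewrite (_ : [set w | _] = (fun w => (M w)%:R : R) @^-1` [set j%:R]).
    by rewrite -[_ @^-1` _]setTI; exact: mM.
  apply/seteqP; split => w /=; first by move=> ->.
  by move/eqP; rewrite eqr_nat => /eqP.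
have mI j : mean P (\1_[set w | M w = j] : Omega -> R) (fine (P [set w | M w = j])).
  split; first exact: integrable_indic.
  by rewrite /Rintegral integral_indic// setIT.
elim: k => [|k IH].
  rewrite expr0; apply: (mean_ext _ (meanB (mean_cst P 1) (mI 0%N))) => w.
  rewrite /I ler_nat indicE; case: (posnP (M w)) => h.
    by rewrite mem_set// subrr.
  by rewrite memNset ?subr0//= => h'; rewrite h' in h.
have E : fine (P [set w | M w = k.+1]) = alpha ^+ k * (1 - alpha) by rewrite PM.
rewrite (_ : _ - p = alpha ^+ k - p - alpha ^+ k * (1 - alpha)); last first.
  by rewrite (exprS alpha k); ring.
rewrite -E; apply: (mean_ext _ (meanB IH (mI k.+1))) => w.
rewrite /I !ler_nat indicE; case: (ltngtP (M w) k.+1) => h.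
- by rewrite memNset ?subrr//= => h'; rewrite h' ltnn in h.
- by rewrite memNset ?subr0//= => h'; rewrite h' ltnn in h.
- by rewrite mem_set// subrr.
Qed.

Let meanI k : mean P (I k.+1) (alpha ^+ k).
Proof.
suff p0 : p = 0 by have := mean_M k; rewrite p0 subr0.
apply/eqP; rewrite eq_le; apply/andP; split; last by rewrite fine_ge0.
have h n : p <= alpha ^+ n.
  by rewrite -subr_ge0; apply: (mean_le (mean_cst P 0) (mean_M n)) => w; exact: ler0n.
have cp : (fun _ : nat => p) @ \oo --> p by exact: cvg_cst.
by apply: (ler_cvg_to cp (cvg_geom alpha01)); exact: nearW.
Qed.

Let mean_V n : mean P (V n) (eb + n%:R * m).
Proof.
apply: meanD; first exact: mean_b.
have := @mean_sum _ _ _ P n (fun k => Z k.+1) (fun=> m) (fun k _ => mZ1 k).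
by rewrite mulr_natl sumr_const card_ord.
Qed.

Let mean_VZ n : mean P (fun w => V n w * Z n.+1 w) ((eb + n%:R * m) * m).
Proof.
pose J1 : set nat := [set j | (j < n.+2)%N]; pose J2 : set nat := [set n.+2].
have J12 : J1 `&` J2 = set0.
  by apply/seteqP; split => // j [jn jE]; move: jn; rewrite jE /J1/= ltnn.
have indJ := mutually_independent_blocks mfam ind J12.
apply: (meanM_indep (@mblk J1) (@mblk J2) indJ _ _ (mean_V n) (mZ1 n)).
  apply: wrtD; first exact: bV.
  by apply: (wrt_sum (f := fun k => Z k.+1)) => k kn; apply: bZ; rewrite /J1/= ltnS.
exact: bZ.
Qed.

(** Where [I n.+1] is nonzero, [X n = V n], so the square grows by [I n.+1] times
    [2 * V n * Z n.+1 + Z n.+1 ^ 2], two independent factors. The two fractions are the partial sums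
    of [alpha ^ k] and of [k * alpha ^ k]. *)
Let mean_X2 n : mean P (fun w => X n w ^+ 2)
  (eb2 + (2 * eb * m + s) * ((1 - alpha ^+ n) / (1 - alpha))
   + 2 * m ^+ 2 * ((alpha - alpha * alpha ^+ n - (1 - alpha) * (n%:R * alpha ^+ n))
                   / (1 - alpha) ^+ 2)).
Proof.
have rho0 : 1 - alpha != 0 by case/andP: alpha01 => _ h; rewrite gt_eqF// subr_gt0.
elim: n => [|n IH].
  rewrite [X in mean _ _ X](_ : _ = eb2); last by rewrite expr0; field.
  by apply: mean_ext mean_b2 => w; rewrite /X big_ord0 addr0.
pose J1 : set nat := [set 1%N]; pose J2 : set nat := [set j | j != 1%N].
have J12 : J1 `&` J2 = set0 by apply/seteqP; split => // j [] /= ->.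
have indJ := mutually_independent_blocks mfam ind J12.
have h2 := meanD (meanZ 2 (mean_VZ n)) (mZ2 n).
have wV : measurable_wrt (blk J2) (fun w => 2 * (V n w * Z n.+1 w) + Z n.+1 w ^+ 2).
  have wZ k : measurable_wrt (blk J2) (Z k.+1) by exact: bZ.
  apply: wrtD; last exact: wrtX.
  apply: wrtM; first exact: wrt_cst.
  apply: wrtM => //; apply: wrtD; first exact: bV.
  by apply: (wrt_sum (f := fun k => Z k.+1)) => k kn.
have h3 := meanM_indep (@mblk J1) (@mblk J2) indJ (@bI J1 n.+1 erefl) wV (meanI n) h2.
have h4 := meanD IH h3.
rewrite [X in mean _ _ X](_ : _ = eb2 + (2 * eb * m + s) * ((1 - alpha ^+ n) / (1 - alpha))
   + 2 * m ^+ 2 * ((alpha - alpha * alpha ^+ n - (1 - alpha) * (n%:R * alpha ^+ n))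
                   / (1 - alpha) ^+ 2)
   + alpha ^+ n * (2 * ((eb + n%:R * m) * m) + s)); last first.
  by rewrite (exprS alpha n) -natr1; field.
apply: mean_ext h4 => w.
rewrite /X big_ord_recr/= -/(X n w) addrA -/(X n w) /I.
case: (boolP (n.+1%:R <= (M w)%:R :> R)) => h; last by rewrite !mul0r !addr0.
have -> : X n w = V n w.
  rewrite /X /V; congr (_ + _); apply: eq_bigr => k _; rewrite /I.
  rewrite (_ : (_ <= _) = true) ?mul1r//.
  by apply: le_trans h; rewrite ler_nat; exact: leqW (ltn_ord k).
by rewrite !mul1r; ring.
Qed.

(** Monotone convergence along [X n ^ 2], which is constant in [n] from [M w] on; the positive parts
    of [Ys] make the sequence nondecreasing. *)
Lemma mean_geometric_sum :
  mean P (fun w => (Num.max theta (Yr w) + \sum_(1 <= k < (M w).+1) Num.max (Ys k w) 0) ^+ 2)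
    (eb2 + 2 * (m / (1 - alpha)) * eb
     + (s + 2 * alpha * (m / (1 - alpha)) * m) / (1 - alpha)).
Proof.
have rho0 : 1 - alpha != 0 by case/andP: alpha01 => _ h; rewrite gt_eqF// subr_gt0.
set F := fun w => _ ^+ 2; set v := (X in mean _ _ X).
have XM n w : (M w <= n)%N -> X n w ^+ 2 = F w.
  move=> Mn; rewrite /F /X; congr ((_ + _) ^+ 2).
  rewrite big_add1/= big_mkord.
  rewrite (big_ord_widen _ (fun k => Num.max (Ys k.+1 w) 0) Mn) [RHS]big_mkcond/=.
  apply: eq_bigr => k _; rewrite /I ler_nat /Z; case: (ltnP k (M w)) => h.
    by rewrite mul1r.
  by rewrite mul0r.
have X0 n w : 0 <= X n w.
  by apply: addr_ge0 => //; apply: sumr_ge0 => k _; apply: mulr_ge0 => //; exact: ler0n.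
have cX w : (X n w ^+ 2 @[n --> \oo] --> F w)%R.
  apply: cvg_near_cst; exists (M w) => // n /= Mn; exact: XM.
have mF : measurable_fun setT F.
  apply: (measurable_fun_cvg (h := fun n w => X n w ^+ 2)) => // n.
  exact: mean_measurable (mean_X2 n).
have cv := @cvg_monotone_convergence _ _ _ P setT measurableT
  (fun n w => (X n w ^+ 2)%:E) _ _ _.
have cvF : (\int[P]_w (X n w ^+ 2)%:E @[n --> \oo] --> \int[P]_w (F w)%:E)%E.
  rewrite [X in _ --> X](_ : _ = \int[P]_w limn (fun n => (X n w ^+ 2)%:E))%E; last first.
    apply: eq_integral => w _; apply/esym/cvg_lim => //.
    by apply: cvg_EFin; [exact: nearW|exact: cX].
  apply: cv.
  - by move=> n; apply/measurable_EFinP; exact: mean_measurable (mean_X2 n).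
  - by move=> n w _; rewrite lee_fin sqr_ge0.
  - move=> w _ i j ij; rewrite lee_fin; apply: lerXn2r; rewrite ?nnegrE//.
    rewrite /X lerD2l (big_ord_widen _ (fun k => I k.+1 w * Z k.+1 w) ij) big_mkcond/=.
    apply: ler_sum => k _; case: ifP => // _; apply: mulr_ge0 => //; exact: ler0n.
have cvv : (\int[P]_w (X n w ^+ 2)%:E @[n --> \oo] --> v%:E)%E.
  rewrite (_ : (fun n => _) = fun n => (eb2 + (2 * eb * m + s) * ((1 - alpha ^+ n) / (1 - alpha))
   + 2 * m ^+ 2 * ((alpha - alpha * alpha ^+ n - (1 - alpha) * (n%:R * alpha ^+ n))
                   / (1 - alpha) ^+ 2))%:E); last first.
    by apply/funext => n; exact: mean_integral (mean_X2 n).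
  apply: cvg_EFin; first exact: nearW.
  rewrite (_ : v = eb2 + (2 * eb * m + s) * ((1 - 0) / (1 - alpha))
   + 2 * m ^+ 2 * ((alpha - alpha * 0 - (1 - alpha) * 0) / (1 - alpha) ^+ 2)); last first.
    by rewrite /v; field.
  have cg := @cvg_geom R alpha alpha01; have cn := @cvg_natmul_geom R alpha alpha01.
  apply: cvgD.
    apply: cvgD; first exact: cvg_cst.
    by apply: cvgMr; apply: cvgMl; apply: cvgB => //; exact: cvg_cst.
  apply: cvgMr; apply: cvgMl; apply: cvgB; last exact: cvgMr.
  by apply: cvgB; [exact: cvg_cst|exact: cvgMr].
have E := cvg_unique _ cvF cvv.
split; last by rewrite /Rintegral E.
apply/integrableP; split; first exact/measurable_EFinP.
rewrite (_ : (fun w => _) = fun w => (F w)%:E) ?E ?ltry//.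
by apply/funext => w /=; rewrite ger0_norm// /F sqr_ge0.
Qed.

End geometric_sum.

Section root_equation.
Context {d : measure_display} {Omega : measurableType d} {R : realType}.
Variables (P : probability Omega R) (alpha eps : R) (Y : nat -> Omega -> R).
Hypotheses (alpha01 : 0 <= alpha < 1) (eps0 : 0 < eps).
Hypothesis mY : forall i, measurable_fun setT (Y i).
Hypothesis Yeps : {ae P, forall w, eps <= Y 1%N w}.
Variables (m s theta K : R).
Local Notation c := (m / (1 - alpha)).
Hypotheses (mY1 : mean P (Y 1%N) m) (mY2 : mean P (fun w => Y 1%N w ^+ 2) s).
Hypothesis theta0 : 0 <= theta.
Hypothesis cYE : cY P Y alpha = c.
Hypothesis KE : K = ((s + 2 * alpha * c * m) / (1 - alpha) - c ^+ 2 - (theta + c) ^+ 2) / 2.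
Hypothesis relvalE : mean P (fun w => relval c theta K (Y 1%N w)) 0.

(** The inner integral is half a difference of squares, and [max (beta - Yr) c] is
    [max theta Yr - Yr + c]. Written with the first two moments of [max theta Yr], the left side of
    the root equation is therefore exactly [E (relval Yr)], expanded as [eqK]. *)
Lemma root_eq_relval : root_eq P Y alpha (theta + c).
Proof.
move=> d' Omega' P' Yr M Ys mYr mM mYs lYr lYs PM ind; rewrite cYE /=.
have rho0 : 1 - alpha != 0 by case/andP: alpha01 => _ h; rewrite gt_eqF// subr_gt0.
have mid : measurable_fun setT (id : R -> R) by exact: measurable_id.
have msq : measurable_fun setT (fun x : R => x ^+ 2) by exact: exprn_measurable.
have mrel : measurable_fun setT (relval c theta K) by exact: measurable_relval.
have Yr1 : mean P' Yr m by exact: (law_eq_mean (g := id) (mY 1%N) mYr lYr mid mY1).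
have Yr2 : mean P' (fun w => Yr w ^+ 2) s.
  exact: (law_eq_mean (g := fun x => x ^+ 2) (mY 1%N) mYr lYr msq mY2).
have Ys1 k : mean P' (Ys k.+1) m.
  exact: (law_eq_mean (g := id) (mY 1%N) (mYs k.+1) (lYs k.+1 isT) mid mY1).
have Ys2 k : mean P' (fun w => Ys k.+1 w ^+ 2) s.
  exact: (law_eq_mean (g := fun x => x ^+ 2) (mY 1%N) (mYs k.+1) (lYs k.+1 isT) msq mY2).
have Ys0 : {ae P', forall w, forall k, 0 <= Ys k.+1 w}.
  apply: ae_foralln => k.
  have : {ae P', forall w, `[eps, +oo[%classic (Ys k.+1 w)}.
    apply: (law_eq_ae (mY 1%N) (mYs k.+1)) => //; first exact: lYs.
    by apply: filterS Yeps => w; rewrite /= in_itv/= andbT.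
  by apply: filterS => w; rewrite /= in_itv/= andbT; apply: le_trans; exact: ltW.
have Yrel : mean P' (fun w => relval c theta K (Yr w)) 0.
  exact: (law_eq_mean (g := relval c theta K) (mY 1%N) mYr lYr mrel relvalE).
pose b w := Num.max theta (Yr w).
set eb := \int[P']_w b w; set eb2 := \int[P']_w (b w ^+ 2).
have mb : mean P' b eb by exact: mean_b theta0 mYr Yr2.
have mb2 : mean P' (fun w => b w ^+ 2) eb2 by exact: mean_b2 mYr Yr2.
have mF := mean_geometric_sum alpha01 theta0 mYr mM mYs PM ind Yr2 Ys1 Ys2 Ys0.
rewrite -/eb -/eb2 in mF.
have eqK : K + 2^-1 * (eb2 - 2 * theta * eb + theta ^+ 2) - 2^-1 * s + (theta + c) * m = 0.
  apply: (mean_unique _ Yrel).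
  have := meanD (meanB (meanD (mean_cst P' K) (meanZ 2^-1 (meanD (meanB mb2
    (meanZ (2 * theta) mb)) (mean_cst P' (theta ^+ 2))))) (meanZ 2^-1 Yr2)) (meanZ (theta + c) Yr1).
  apply: mean_ext => w; rewrite /relval /b; case: (leP theta (Yr w)) => h.
    by rewrite maxr_idl; [field|lra].
  by rewrite maxr_idr; [field|lra].
have I1 := meanZ 2^-1 (meanB mF Yr2).
set v := 2^-1 * _ in I1.
have -> : (\int[P']_w \int[@lebesgue_measure R]_(t in
     `[Yr w, (Num.max (theta + c - c) (Yr w) + \sum_(1 <= k < (M w).+1) Ys k w)%R]) t%:E)%E = v%:E.
  rewrite -(mean_integral I1); apply: eq_integral_ae; apply: filterS Ys0 => w h.
  have -> : theta + c - c = theta by ring.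
  rewrite (_ : \sum_(1 <= k < (M w).+1) Ys k w =
      \sum_(1 <= k < (M w).+1) Num.max (Ys k w) 0); last first.
    by rewrite !big_add1/=; apply: eq_bigr => k _; rewrite maxr_idl.
  set q := _ + _.
  have pq : Yr w <= q.
    rewrite /q; apply: (@le_trans _ _ (Num.max theta (Yr w))); first by rewrite le_max lexx orbT.
    by rewrite lerDl; apply: sumr_ge0 => k _; rewrite le_max lexx orbT.
  have := integral_affine 0 pq; rewrite !subr0 mulrC => <-.
  by apply: eq_integral => t _; rewrite subr0.
have mE : mean P' (fun w => Num.max (theta + c - Yr w) c) (eb - m + c).
  have := meanD (meanB mb Yr1) (mean_cst P' c).
  apply: mean_ext => w; rewrite /b; case: (leP theta (Yr w)) => h.
    by rewrite maxr_idr; [ring|lra].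
  by rewrite maxr_idl; [ring|lra].
rewrite unlock (mean_integral mE) -EFinM -EFinB; congr EFin.
rewrite -eqK /v KE; field.
by [].
Qed.

End root_equation.

Theorem mainTheorem10 (d : measure_display) (Omega : measurableType d) (R : realType)
  (P : probability Omega R) (alpha eps : R)
  (Y : nat -> Omega -> R) (succ : nat -> Omega -> bool) :
  0 <= alpha < 1 -> 0 < eps ->
  (forall i, measurable_fun setT (Y i)) ->
  (forall i, measurable_fun setT (@succR _ _ R succ i)) ->
  mutually_independent P (sys_family Y succ) ->
  (forall i, (1 <= i)%N -> law_eq P P (Y i) (Y 1%N)) ->
  (forall i, (1 <= i)%N -> P [set w | succ i w] = (1 - alpha)%:E) ->
  {ae P, forall w, eps <= Y 1%N w} ->
  ('E_P[fun w => (Y 1%N w ^+ 2)%R] < +oo)%E ->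
  exists beta : R,
    [/\ age_opt P Y succ = beta%:E,
        root_eq P Y alpha beta,
        (exists pi, in_Pi P Y succ pi /\ threshold_policy P Y succ pi (beta - cY P Y alpha)) &
        (forall pi, in_Pi P Y succ pi -> threshold_policy P Y succ pi (beta - cY P Y alpha) ->
           avg_cost P Y succ pi = beta%:E)].
Proof.
move=> a01 e0 mY ms ind law Ps Ye Y2.
have mY1 := mean_Y e0 mY law Ye Y2.
have mY2 := mean_Ysq mY law Ye Y2.
have mYr := mean_Yraw e0 mY law Ye Y2.
have Yae := Yc_ae mY law Ye.
set m := EY P eps Y in mY1 mYr; set s := EYsq P eps Y in mY2.
have cE : cY P Y alpha = m / (1 - alpha) by exact: (cYE alpha e0 mY law Ye Y2).
have s_ge : m ^+ 2 <= s by exact: EYsq_ge e0 mY law Ye Y2.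
have Yc0 w : 0 <= Yc eps Y 1%N w by exact: le_trans (ltW e0) (Yc_ge _ _ _ _).
have [theta th0 rvE] := threshold_root_exists a01 Yc0 mY1 mY2 s_ge.
set c := m / (1 - alpha) in cE rvE.
set K := _ / 2 in rvE.
have bE : theta + c - cY P Y alpha = theta by rewrite cE; ring.
have lower pi : in_Pi P Y succ pi -> ((theta + c)%:E <= avg_cost P Y succ pi)%E.
  exact: (avg_cost_ge a01 e0 mY ms ind law Ps Ye Y2 (c := c) (theta := theta) (K := K)).
(* The threshold property concerns the raw [Y], the cost bounds the clamped one. Off a single null
   set, common to all indices, the two trajectories coincide. *)
have waits pi : in_Pi P Y succ pi -> threshold_policy P Y succ pi theta ->
    {ae P, forall w, forall i, pol_Z pi i w = Num.max (theta -
      path_age (fun i => Yc eps Y i w) (fun i => pol_Z pi i w) (fun i => succ i w) i) 0}.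
  move=> [_ _ z0 _ _] /ae_foralln thr; move: (thr); apply: filterS2 Yae => w hw hthr.
  have yw i : eps <= Y i.+1 w by rewrite -hw; exact: Yc_ge.
  move=> i; rewrite (threshold_wait e0 yw (fun i => z0 i w) hthr) /path_age.
  by rewrite (path_deliv_ext (y' := fun i => Y i w) _ hw)
    (path_last_ext (y' := fun i => Y i w) _ _ hw).
have opt pi : in_Pi P Y succ pi -> threshold_policy P Y succ pi theta ->
    avg_cost P Y succ pi = (theta + c)%:E.
  move=> hpi hthr; apply/eqP; rewrite eq_le lower// andbT.
  apply: (avg_cost_le a01 e0 mY ms ind law Ps Ye Y2 (c := c) (theta := theta) (K := K)) => //.
  exact: waits.
have pin : in_Pi P Y succ (thr_pol eps theta Y succ) by exact: thr_pol_in_Pi.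
have pthr : threshold_policy P Y succ (thr_pol eps theta Y succ) theta.
  move=> i; apply: filterS Yae => w hw.
  have yw j : eps <= Y j.+1 w by rewrite -hw; exact: Yc_ge.
  apply: (wait_threshold e0 yw) => [j|j]; first by case: pin.
  rewrite [LHS]/= -(thr_ageE eps theta Y succ j w) /path_age.
  by rewrite (path_deliv_ext (y' := fun i => Y i w) _ hw)
    (path_last_ext (y' := fun i => Y i w) _ _ hw).
exists (theta + c); rewrite bE; split.
- apply/eqP; rewrite eq_le; apply/andP; split.
    by apply: ereal_inf_lbound; exists (thr_pol eps theta Y succ) => //; exact: opt.
  by apply: le_ereal_inf_tmp => _ [pi hpi <-]; exact: lower.
- apply: (root_eq_relval a01 e0 mY Ye (K := K) mYr (s := s)) => //.
  + apply: (mean_ae mY2); first exact: measurable_funX.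
    by apply: filterS Yae => w ->.
  + apply: (mean_ae rvE); first by apply: measurableT_comp => //; exact: measurable_relval.
    by apply: filterS Yae => w ->.
- by exists (thr_pol eps theta Y succ).
- exact: opt.
Qed.
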